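(* Let $N\ge1$ be an integer, $p,q>1$, and $\sigma,\gamma>-1$ with $\sigma,\gamma\neq0$. Suppose that $u_0,v_0\in C_0(\mathbb{R}^N)$ and $w_i\in C_0(\mathbb{R}^N)\cap L^1(\mathbb{R}^N)$ are such that $\int_{\mathbb{R}^N}w_i(x)\,dx>0$, $i=1,2$. Let $(u,v)$ be the (maximal) mild solution to $$u_t-\Delta u=|v|^p+t^\sigma w_1(x),\quad v_t-\Delta v=|u|^q+t^\gamma w_2(x)\quad (x\in\mathbb{R}^N,\ t>0),\qquad (u(0,x),v(0,x))=(u_0(x),v_0(x)).$$ Then the following holds: (i) If $\sigma,\gamma\in(-1,0)$ and $$\frac{N}{2}<\max\left\{\frac{(\sigma+1)(pq-1)+p+1}{pq-1},\ \frac{(\gamma+1)(pq-1)+q+1}{pq-1}\right\},$$ then $(u,v)$ blows up in finite time. (ii) If $\sigma>0$ or $\gamma>0$, then (for any $p,q>1$) $(u,v)$ blows up in finite time.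
   Context: $C_0(\mathbb{R}^N)$ denotes the set of all continuous (real-valued) functions on $\mathbb{R}^N$ decaying to zero at infinity, with the supremum norm. $S(t)=e^{t\Delta}$ is the heat semigroup on $\mathbb{R}^N$. Mild solution: for $T>0$, a pair $(u,v)\in C([0,T],C_0(\mathbb{R}^N)\times C_0(\mathbb{R}^N))$ is a mild solution to the problem (on $[0,T]$) if for all $0\le t\le T$ $$u(t)=S(t)u_0+\int_0^t S(t-s)|v(s)|^p\,ds+\int_0^t s^\sigma S(t-s)w_1\,ds,$$ $$v(t)=S(t)v_0+\int_0^t S(t-s)|u(s)|^q\,ds+\int_0^t s^\gamma S(t-s)w_2\,ds.$$ For data in $C_0(\mathbb{R}^N)$ the mild solution exists, is unique, and extends to a maximal interval $[0,T_{\max})$, where $T_{\max}\in(0,\infty]$ is the supremum of all $\tau>0$ such that a mild solution exists in $C([0,\tau],C_0(\mathbb{R}^N)\times C_0(\mathbb{R}^N))$. ''Blows up in finite time'' means $T_{\max}<\infty$, in which case $\lim_{t\to T_{\max}^-}\left(\|u\|_{L^\infty((0,t)\times\mathbb{R}^N)}+\|v\|_{L^\infty((0,t)\times\mathbb{R}^N)}\right)=\infty$. *)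

(* Defs.v *)
From HB Require Import structures.
From mathcomp Require Import all_boot all_order all_algebra.
From mathcomp Require Import all_classical all_reals all_analysis.
Set Implicit Arguments.
Unset Strict Implicit.
Unset Printing Implicit Defensive.
Import Order.TTheory GRing.Theory Num.Theory.
Import numFieldNormedType.Exports.

Local Open Scope classical_set_scope.
Local Open Scope ring_scope.

Section lebesgueN.
Context {R : realType}.

Definition rtuple_cons (n : nat) (z : n.-tuple R * R) : n.+1.-tuple R :=
  [tuple of z.2 :: z.1].

Lemma measurable_rtuple_cons (n : nat) :
  measurable_fun [set: n.-tuple R * R] (@rtuple_cons n).
Proof. exact: measurable_cons. Qed.

Section succ.
Variables (n : nat) (mu : {measure set (n.-tuple R) -> \bar R}).

Definition lebesgue_succ : set (n.+1.-tuple R) -> \bar R :=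
  pushforward (mu \x @lebesgue_measure R)%E (@rtuple_cons n).

HB.instance Definition _ := Measure.copy lebesgue_succ
  (measure_function_pushforward__canonical__measure_function_Measure
     (mu \x @lebesgue_measure R)%E (@measurable_rtuple_cons n)).
End succ.

(* Lebesgue measure on R^n, built on the product sigma-algebra that the library
   puts on n.-tuple R; [lebesgueN_box] is the usual normalization. *)
Fixpoint lebesgueN (n : nat) : {measure set (n.-tuple R) -> \bar R} :=
  match n with
  | 0 => \d_ [tuple]
  | m.+1 => lebesgue_succ (lebesgueN m)
  end.

Lemma lebesgueN_box (n : nat) (a b : 'I_n -> R) : (forall i, a i <= b i) ->
  lebesgueN n [set x | forall i, tnth x i \in `[a i, b i]] =
  (\prod_(i < n) (b i - a i))%:E.
Proof.
elim: n a b => [|n IH] a b ab.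
  rewrite big_ord0 /= diracE mem_set//=; by case.
rewrite big_ord_recl EFinM /= /lebesgue_succ /pushforward.
have mI (c d : R) : measurable (`[c, d]%classic : set R) by [].
rewrite (_ : _ @^-1` _ = [set x : n.-tuple R | forall i, tnth x i \in
   `[a (lift ord0 i), b (lift ord0 i)]] `*` `[a ord0, b ord0]%classic); last first.
  apply/seteqP; split=> -[x y] /=.
    move=> h; split; last by have := h ord0; rewrite /= tnth0.
    by move=> i; have := h (lift ord0 i); rewrite /= tnthS.
  move=> [h1 h2] i; have [j ->|->] := unliftP ord0 i; last by rewrite /= tnth0.
  by rewrite tnthS; exact: h1.
rewrite product_measure1E//; last first.
  rewrite (_ : [set x | _] = \bigcap_(i in [set: 'I_n])
    ((fun x : n.-tuple R => tnth x i) @^-1` `[a (lift ord0 i), b (lift ord0 i)]%classic)); last first.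
    by apply/seteqP; split=> x /= h i; [move=> _; exact: h|exact: (h i I)].
  apply: fin_bigcap_measurable => // i _.
  rewrite -[X in measurable X]setTI; exact: measurable_tnth.
rewrite IH// muleC; congr (_ * _)%E; rewrite [LHS]lebesgue_measure_itv/=.
rewrite lte_fin; case: ltP => // ba.
suff -> : a ord0 = b ord0 by rewrite subrr.
by apply/eqP; rewrite eq_le ab ba.
Qed.

End lebesgueN.

Section heat.
Context {R : realType} {N : nat}.
Local Notation RN := 'rV[R]_N.
Implicit Types (f g : RN -> R) (u v : R -> RN -> R).

(* 'rV[R]_N carries the topology and n.-tuple R the sigma-algebra. *)
Definition rV_of_tuple (x : N.-tuple R) : RN := \row_(i < N) tnth x i.

Definition integral_RN f : R := (\int[lebesgueN N]_x f (rV_of_tuple x))%R.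

Definition L1_RN : set (RN -> R) :=
  [set f | (lebesgueN N).-integrable setT (fun x => (f (rV_of_tuple x))%:E)].

(* The norm on 'rV[R]_N is the maximum norm; decay at infinity is the same
   notion for every norm on R^N. *)
Definition C0_RN : set (RN -> R) :=
  [set f | continuous f /\
    forall e : R, 0 < e -> exists M : R, forall x : RN, M < `|x| -> `|f x| < e].

(* Squared Euclidean norm. *)
Definition sqnorm (x : RN) : R := \sum_(i < N) x 0 i ^+ 2.

Definition heat_kernel (t : R) (x : RN) : R :=
  (4 * pi * t) `^ (- (N%:R / 2)) * expR (- (sqnorm x / (4 * t))).

(* e^{t Delta}, for t >= 0. *)
Definition heat_semigroup (t : R) f : RN -> R :=
  if t == 0 then f
  else fun x => integral_RN (fun y => heat_kernel t (x - y) * f y).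

(* C([0,T], C_0(R^N)): {uniform _ -> _} is the topology of uniform convergence,
   i.e. that of the supremum norm. *)
Definition C_in_C0 (T : R) : set (R -> RN -> R) :=
  [set u | (forall t : R, t \in `[0, T] -> C0_RN (u t)) /\
    {within `[0, T], continuous (u : R -> {uniform RN -> R})}].

(* Right-hand side of the Duhamel formula at (t, x). The C_0-valued integrals
   are written pointwise in x: evaluation at x is continuous on C_0 and
   s `^ a is integrable at 0 for a > -1. *)
Definition duhamel (a r : R) (f0 w : RN -> R) (g : R -> RN -> R)
    (t : R) (x : RN) : R :=
  heat_semigroup t f0 x
  + (\int[lebesgue_measure]_(s in `[0, t])
       heat_semigroup (t - s) (fun y => `|g s y| `^ r) x)%R
  + (\int[lebesgue_measure]_(s in `[0, t])
       (s `^ a * heat_semigroup (t - s) w x))%R.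

Definition mild_solution (p q sigma gamma : R) (u0 v0 w1 w2 : RN -> R)
    (T : R) (u v : R -> RN -> R) : Prop :=
  [/\ C_in_C0 T u, C_in_C0 T v &
    forall t x, 0 <= t <= T ->
      u t x = duhamel sigma p u0 w1 v t x /\
      v t x = duhamel gamma q v0 w2 u t x].

Definition Tmax (p q sigma gamma : R) (u0 v0 w1 w2 : RN -> R) : \bar R :=
  ereal_sup [set tau%:E | tau in [set tau : R | 0 < tau /\
    exists u v, mild_solution p q sigma gamma u0 v0 w1 w2 tau u v]].

(* (u, v) is the solution on [0, Tmax); values at later times are irrelevant. *)
Definition maximal_mild_solution (p q sigma gamma : R)
    (u0 v0 w1 w2 : RN -> R) (u v : R -> RN -> R) : Prop :=
  let T := Tmax p q sigma gamma u0 v0 w1 w2 in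
  (0 < T)%E /\
  forall tau : R, 0 < tau -> (tau%:E < T)%E ->
    mild_solution p q sigma gamma u0 v0 w1 w2 tau u v.

Definition blows_up_in_finite_time (p q sigma gamma : R)
    (u0 v0 w1 w2 : RN -> R) : Prop :=
  (Tmax p q sigma gamma u0 v0 w1 w2 < +oo)%E.

End heat.

(* Main.v *)
Require Import Defs.
From HB Require Import structures.
From mathcomp Require Import all_boot all_order all_algebra.
From mathcomp Require Import all_classical all_reals all_analysis.
From mathcomp Require Import measurable_realfun.
From mathcomp Require Import ring lra.
Set Implicit Arguments.
Unset Strict Implicit.
Unset Printing Implicit Defensive.
Import Order.TTheory GRing.Theory Num.Theory.
Import numFieldNormedType.Exports.

Local Open Scope classical_set_scope.
Local Open Scope ring_scope.

(** Why the theorem holds. Suppose that the solution were global. Fix a time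
    window [A, A + L] and the later time T = A + 2 L, and test the equations
    against the backward heat kernel G(T - t, x), which solves the adjoint heat
    equation exactly, so that no Laplacian is left over. In terms of the mild
    formulation this is the semigroup property: with S the heat semigroup,
    U(t) = (S(T - t) u(t))(0) satisfies
      U(t) = (S(T) u0)(0) + int_0^t (S(T - s) |v(s)|^p)(0) ds
                          + int_0^t s^sigma (S(T - s) w1)(0) ds
    ([mild_pairing]), and V(t) = (S(T - t) v(t))(0) satisfies the analogous
    identity. The initial datum contributes a constant, which disappears when the
    identity is tested in time against the derivative of a cutoff that vanishes at
    both ends of the window ([Rintegral_triangle]).

    Young's inequality under the kernel ([young_weighted]) bounds the tested U by
    lam times the tested source |u|^q plus a power of L and lam. This gives
    [tested_inequality] for each equation: with weight lam for the first one and
    1/lam for the second one the two sources cancel, and only the forcing remains.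
    Since w1 has positive mass, (S(t) w1)(0) >= c t^(-N/2) for large t, by
    dominated convergence ([heat_origin_ge]). Hence ([forcing_bound])
      C1 min_(window) s^sigma L^(-N/2) <=
        C2 (lam^(p/(p-1)) L^(-p/(p-1)) + lam^(-1/(q-1)) L^(-q/(q-1)))
    for all A > 0, all large L and all lam > 0, where C1 > 0 and C2 do not depend
    on A, L, lam.

    When sigma > 0, keep L and lam fixed and let A tend to infinity: the left side
    is unbounded. When sigma < 0, take A = L and let lam be the power of L for
    which the two terms on the right have the same exponent
    -p(q+1)/(pq-1); letting L tend to infinity contradicts
    N/2 < sigma + p(q+1)/(pq-1), which is the first of the two alternatives of the
    dimension condition. The statements for gamma follow by exchanging the two
    equations. *)

(** * Measurability and Fubini's theorem for real-valued integrals *)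

Section measure_tools.
Context {R : realType}.

(** By the identity x^-1 = x (x^2)^(-1), valid also at x = 0, this is an instance of
    the measurability of [powR]. *)
Lemma measurable_invr : measurable_fun [set: R] (fun x : R => x^-1).
Proof.
rewrite (_ : (fun x => _) = fun x : R => x * (x ^+ 2) `^ (-1)); last first.
  apply/funext => x; rewrite powR_inv1 ?sqr_ge0//.
  have [->|x0] := eqVneq x 0; first by rewrite invr0 mul0r.
  by rewrite expr2 invfM mulrA divff// mul1r.
apply: measurable_funM => //.
exact: (@measurableT_comp _ _ _ _ _ _ (fun y : R => y `^ (-1))).
Qed.

Lemma measurable_fun_Rintegral d1 d2 (T1 : measurableType d1)
    (T2 : measurableType d2) (m2 : {sigma_finite_measure set T2 -> \bar R})
    (f : T1 * T2 -> R) : measurable_fun setT f ->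
  measurable_fun setT (fun x => (\int[m2]_y f (x, y))%R).
Proof.
move=> mf.
have mEf : measurable_fun setT (EFin \o f) by exact/measurable_EFinP.
apply: (measurableT_comp (fine_measurable measurableT)).
under eq_fun do rewrite integralE.
apply: emeasurable_funB.
- rewrite (_ : (fun _ => _) = fubini_F m2 (EFin \o f)^\+%E); last first.
    by apply/funext => x; apply: eq_integral => y _; rewrite !funeposE.
  by apply: measurable_fun_fubini_tonelli_F => //; exact: measurable_funepos.
- rewrite (_ : (fun _ => _) = fubini_F m2 (EFin \o f)^\-%E); last first.
    by apply/funext => x; apply: eq_integral => y _; rewrite !funenegE.
  by apply: measurable_fun_fubini_tonelli_F => //; exact: measurable_funeneg.
Qed.

(** The inner integrals that do not converge, to which [Rintegral] gives the
    value 0, concern only a null set of the outer variable. *)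
Lemma Rintegral_swap d1 d2 (T1 : measurableType d1) (T2 : measurableType d2)
    (m1 : {sigma_finite_measure set T1 -> \bar R})
    (m2 : {sigma_finite_measure set T2 -> \bar R}) (f : T1 * T2 -> R) :
  (m1 \x m2)%E.-integrable setT (EFin \o f) ->
  (\int[m1]_x (\int[m2]_y f (x, y)) = \int[m2]_y (\int[m1]_x f (x, y)))%R.
Proof.
move=> fi.
have mf : measurable_fun setT f by case/integrableP: fi => /measurable_EFinP.
transitivity (fine (\int[m1]_x \int[m2]_y (f (x, y))%:E)%E).
  congr fine; apply: ae_eq_integral => //=.
  - by apply/measurable_EFinP; exact: measurable_fun_Rintegral.
  - exact: (measurable_fubini_F fi).
  - have := ae_integrable1 fi; apply: filterS => x fx _.
    by rewrite fineK//; exact: integrable_fin_num.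
have -> := Fubini fi.
congr fine; apply: ae_eq_integral => //=.
- exact: (measurable_fubini_G fi).
- apply/measurable_EFinP.
  apply: (@measurable_fun_Rintegral _ _ _ _ m1 (fun z => f (z.2, z.1))) => //.
  by apply: (measurableT_comp mf); exact: measurable_swap.
- have := ae_integrable2 fi; apply: filterS => x fx _.
  by rewrite fineK//; exact: integrable_fin_num.
Qed.

(** Used for discretizations: [c x] is the cell of a countable grid in which [x]
    lies, and each cell comes with its own function. *)
Lemma measurable_countable_family d (T : measurableType d) (I : countType)
    (c : T -> I) (F : I -> T -> R) :
  (forall i, measurable (c @^-1` [set i])) ->
  (forall i, measurable_fun setT (F i)) ->
  measurable_fun setT (fun x => F (c x) x).
Proof.
move=> mc mF _ Y mY; rewrite setTI.
rewrite (_ : _ @^-1` _ =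
    \bigcup_(i in [set: I]) (c @^-1` [set i] `&` F i @^-1` Y)).
  apply: countable_bigcupT_measurable; first exact: countableP.
  move=> i; apply: measurableI => //.
  by rewrite -[X in measurable X]setTI; exact: mF.
apply/seteqP; split => x /=; first by move=> Yx; exists (c x).
by case=> i _ [<-].
Qed.

Lemma integrable_le d (T : measurableType d) (m : {measure set T -> \bar R})
    (f g : T -> R) : measurable_fun setT f -> m.-integrable setT (EFin \o g) ->
  (forall x, `|f x| <= g x) -> m.-integrable setT (EFin \o f).
Proof.
move=> mf ig fg; apply: le_integrable ig => //=; first exact/measurable_EFinP.
by move=> x _; rewrite lee_fin (le_trans (fg x))// ler_norm.
Qed.

Lemma indicM_patch d (T : measurableType d) (D : set T) (f : T -> R) :
  (fun x => \1_D x * f x) = f \_ D.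
Proof.
apply/funext => x; rewrite indicE patchE; case: ifP => _; last by rewrite mul0r.
by rewrite mul1r.
Qed.

Lemma Rintegral_indicM d (T : measurableType d) (m : {measure set T -> \bar R})
    (D : set T) (f : T -> R) :
  (\int[m]_(x in D) f x)%R = (\int[m]_x (\1_D x * f x))%R.
Proof. by rewrite Rintegral_mkcond indicM_patch. Qed.

Lemma integrable_indicM d (T : measurableType d) (m : {measure set T -> \bar R})
    (D : set T) (f : T -> R) : measurable D ->
  m.-integrable D (EFin \o f) <->
  m.-integrable setT (EFin \o (fun x => \1_D x * f x)).
Proof.
by move=> mD; rewrite indicM_patch -restrict_EFin; exact: integrable_mkcond.
Qed.

End measure_tools.

(** * Lebesgue measure on tuples *)

Section product_measure.
Context {R : realType}.

Lemma lebesgueN_sigma_finite n : sigma_finite setT (@lebesgueN R n).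
Proof.
exists (fun k : nat => [set x | forall i, tnth x i \in `[- k%:R, k%:R]]).
  apply/seteqP; split => // x _.
  exists (\max_(i < n) (Num.truncn `|tnth x i|).+1)%N => // i.
  rewrite in_itv/= -ler_norml (le_trans (ltW (truncnS_gt _)))// ler_nat.
  exact: (leq_bigmax i).
move=> k; split.
  rewrite (_ : [set x | _] = \bigcap_(i in [set: 'I_n])
      ((fun x : n.-tuple R => tnth x i) @^-1` `[- k%:R, k%:R]%classic)); last first.
    by apply/seteqP; split=> x /= h i; [move=> _; exact: h|exact: (h i I)].
  apply: fin_bigcap_measurable => // i _.
  by rewrite -[X in measurable X]setTI; exact: measurable_tnth.
by rewrite lebesgueN_box ?ltry// => i; rewrite ge0_cp.
Qed.

(** Instances such as sigma-finiteness are found through the head constant of a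
    set function; [lebesgueN n] is a packed measure without one, so it is given
    a name. *)
Definition muN n : set (n.-tuple R) -> \bar R := @lebesgueN R n.
HB.instance Definition _ n := Measure.copy (@muN n) (@lebesgueN R n).
HB.instance Definition _ n :=
  @Measure_isSigmaFinite.Build _ _ _ (@muN n) (lebesgueN_sigma_finite n).

(** By Tonelli's theorem, one coordinate at a time. *)
Lemma integral_muN_prod n (k : 'I_n -> R -> R) (c : 'I_n -> R) :
  (forall i, measurable_fun setT (k i)) -> (forall i x, 0 <= k i x) ->
  (forall i, \int[@lebesgue_measure R]_y (k i y)%:E = (c i)%:E)%E ->
  (\int[@muN n]_x (\prod_(i < n) k i (tnth x i))%:E = (\prod_(i < n) c i)%:E)%E.
Proof.
elim: n k c => [|n IH] k c mk k0 kc.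
  rewrite big_ord0; under eq_integral do rewrite big_ord0.
  by rewrite integral_cst//= mul1e /muN /= diracT.
have mP m (h : 'I_m -> R -> R) : (forall i, measurable_fun setT (h i)) ->
    measurable_fun [set: m.-tuple R] (fun x => \prod_(i < m) h i (tnth x i)).
  move=> mh; apply: measurable_prod => i _.
  by apply: measurableT_comp => //; exact: measurable_tnth.
have P0 m (h : 'I_m -> R -> R) (x : m.-tuple R) : (forall i x, 0 <= h i x) ->
    0 <= \prod_(i < m) h i (tnth x i) by move=> h0; exact: prodr_ge0.
rewrite /muN /= /lebesgue_succ ge0_integral_pushforward//; last 3 first.
- exact: measurable_rtuple_cons.
- by apply/measurable_EFinP; exact: mP.
- by move=> x _; rewrite lee_fin P0.
rewrite preimage_setT.
rewrite [LHS](fubini_tonelli1 (m1 := @muN n) (m2 := @lebesgue_measure R)) /=; last 2 first.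
- apply/measurable_EFinP.
  exact: (measurableT_comp (mP _ _ mk) (@measurable_rtuple_cons R n)).
- by move=> x; rewrite lee_fin P0.
rewrite big_ord_recl EFinM -(IH (fun i => k (lift ord0 i)))//.
rewrite -ge0_integralZl//; last 3 first.
- by apply/measurable_EFinP; exact: (mP _ (fun i => k (lift ord0 i))).
- by move=> x _; rewrite lee_fin (P0 _ (fun i => k (lift ord0 i))).
- by rewrite -kc integral_ge0// => x _; rewrite lee_fin.
apply: eq_integral => x _; rewrite /fubini_F.
transitivity (\int[@lebesgue_measure R]_y
    ((\prod_(i < n) k (lift ord0 i) (tnth x i))%:E * (k ord0 y)%:E))%E.
  apply: eq_integral => y _ /=; rewrite big_ord_recl tnth0 EFinM muleC.
  by congr (_%:E * _)%E; apply: eq_bigr => i _; rewrite tnthS.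
rewrite ge0_integralZl// ?kc 1?muleC//.
- by apply/measurable_EFinP; exact: mk.
- by move=> y _; rewrite lee_fin.
- by rewrite lee_fin (P0 _ (fun i => k (lift ord0 i))).
Qed.

End product_measure.

(** * The heat kernel *)

Section gaussian.
Context {R : realType}.
Local Notation leb := (@lebesgue_measure R).

Definition heat_kernel1 (t x : R) : R :=
  (4 * pi * t) `^ (- 2^-1) * expR (- (x ^+ 2 / (4 * t))).

Lemma heat_kernel1_ge0 t x : 0 <= heat_kernel1 t x.
Proof. by rewrite mulr_ge0 ?powR_ge0 ?expR_ge0. Qed.

Lemma heat_kernel1N t x : heat_kernel1 t (- x) = heat_kernel1 t x.
Proof. by rewrite /heat_kernel1 sqrrN. Qed.

Lemma measurable_heat_kernel1 (t m : R) :
  measurable_fun [set: R] (fun x : R => heat_kernel1 t (x - m)).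
Proof.
apply: measurable_funM => //.
apply: measurableT_comp => //; apply: measurableT_comp => //.
apply: measurable_funM => //; apply: measurable_funX.
exact: measurable_funB.
Qed.

Lemma integral_heat_kernel1 t m : 0 < t ->
  (\int[leb]_x (heat_kernel1 t (x - m))%:E = 1)%E.
Proof.
move=> t0; rewrite -(integral_normal_pdf m (Num.sqrt (2 * t))).
have s0 : Num.sqrt (2 * t) != 0 by rewrite gt_eqF// sqrtr_gt0 mulr_gt0.
apply: eq_integral => x _; rewrite normal_pdfE// /heat_kernel1 /normal_peak.
rewrite /normal_fun sqr_sqrtr ?mulr_ge0 1?ltW//.
have p0 : 0 <= 4 * pi * t :> R by rewrite !mulr_ge0// ?pi_ge0// ltW.
rewrite powRN powR12_sqrt//; congr (_%:E); congr (_^-1 * expR _).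
  by congr Num.sqrt; rewrite -mulr_natr; ring.
by rewrite mulNr; congr (- (_ / _)); rewrite -mulr_natr; ring.
Qed.

(** The semigroup property of the Gaussian before integration: completing the
    square in [x] shows that the product of two Gaussians is a Gaussian in [a - b]
    times a probability density in [x]. *)
Lemma heat_kernel1_mul s t a b x : 0 < s -> 0 < t ->
  heat_kernel1 s (a - x) * heat_kernel1 t (x - b) =
  heat_kernel1 (s + t) (a - b) *
  heat_kernel1 (s * t / (s + t)) (x - (t * a + s * b) / (s + t)).
Proof.
move=> s0 t0; have st0 : 0 < s + t by rewrite addr_gt0.
rewrite /heat_kernel1 mulrACA [RHS]mulrACA -!expRD; congr (_ * expR _).
  have P r : 0 < r -> 0 <= 4 * pi * r :> R.
    by move=> r0; rewrite !mulr_ge0 ?pi_ge0// ltW.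
  rewrite -!powRM ?P ?divr_gt0 ?mulr_gt0//; congr (_ `^ _).
  by field; rewrite gt_eqF.
by field; rewrite !gt_eqF.
Qed.

Lemma integral_heat_kernel1_mul s t a b : 0 < s -> 0 < t ->
  (\int[leb]_x (heat_kernel1 s (a - x) * heat_kernel1 t (x - b))%:E =
  (heat_kernel1 (s + t) (a - b))%:E)%E.
Proof.
move=> s0 t0; under eq_integral do rewrite heat_kernel1_mul// EFinM.
rewrite ge0_integralZl//=.
- by rewrite integral_heat_kernel1 ?mule1// divr_gt0 ?mulr_gt0 ?addr_gt0.
- by apply/measurable_EFinP; exact: measurable_heat_kernel1.
- by move=> x _; rewrite lee_fin heat_kernel1_ge0.
- by rewrite lee_fin heat_kernel1_ge0.
Qed.

Context {N : nat}.
Local Notation X := (N.-tuple R).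
Local Notation mu := (@muN R N).

(** The heat kernel between two points, on the type that carries the measure. *)
Definition kernel (t : R) (x y : X) : R :=
  heat_kernel t (rV_of_tuple x - rV_of_tuple y).

(** The exponent is a sum over coordinates, hence every integral of the kernel
    reduces to dimension one by [integral_muN_prod]. *)
Lemma kernel_prod t x y : 0 < t ->
  kernel t x y = \prod_(i < N) heat_kernel1 t (tnth x i - tnth y i).
Proof.
move=> t0; rewrite /kernel /heat_kernel /heat_kernel1 big_split /=.
rewrite prodr_const card_ord -powR_mulrn ?powR_ge0// -powRrM; congr (_ `^ _ * _).
  by rewrite mulNr mulrC.
rewrite -expR_sum /sqnorm mulr_suml -sumrN; congr expR.
by apply: eq_bigr => i _; rewrite !mxE.
Qed.

Lemma kernel_ge0 t x y : 0 <= kernel t x y.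
Proof. by rewrite mulr_ge0 ?powR_ge0 ?expR_ge0. Qed.

Lemma kernelC t x y : kernel t x y = kernel t y x.
Proof.
rewrite /kernel /heat_kernel; suff -> : sqnorm (rV_of_tuple x - rV_of_tuple y) =
  sqnorm (rV_of_tuple y - rV_of_tuple x) by [].
by apply: eq_bigr => i _; rewrite !mxE -sqrrN opprB.
Qed.

Lemma integral_kernell t y : 0 < t -> (\int[mu]_x (kernel t x y)%:E = 1)%E.
Proof.
move=> t0; under eq_integral do rewrite kernel_prod//.
rewrite (@integral_muN_prod _ _ (fun i x => heat_kernel1 t (x - tnth y i)) (fun=> 1)).
- by rewrite big1.
- by move=> i; exact: measurable_heat_kernel1.
- by move=> i x; exact: heat_kernel1_ge0.
- by move=> i; exact: integral_heat_kernel1.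
Qed.

Lemma integral_kernelr t x : 0 < t -> (\int[mu]_y (kernel t x y)%:E = 1)%E.
Proof.
by move=> t0; under eq_integral do rewrite kernelC; exact: integral_kernell.
Qed.

Lemma integral_kernel_mul s t a b : 0 < s -> 0 < t ->
  (\int[mu]_x (kernel s a x * kernel t x b)%:E = (kernel (s + t) a b)%:E)%E.
Proof.
move=> s0 t0; rewrite kernel_prod ?addr_gt0//.
under eq_integral do rewrite !kernel_prod// -big_split /=.
apply: (@integral_muN_prod _ _ (fun i x =>
  heat_kernel1 s (tnth a i - x) * heat_kernel1 t (x - tnth b i))) => i.
- apply: measurable_funM; last exact: measurable_heat_kernel1.
  rewrite (_ : (fun x => _) = fun x => heat_kernel1 s (x - tnth a i)).
    exact: measurable_heat_kernel1.
  by apply/funext => x; rewrite -heat_kernel1N opprB.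
- by move=> x; rewrite mulr_ge0 ?heat_kernel1_ge0.
- exact: integral_heat_kernel1_mul.
Qed.

Lemma measurable_kernel d (T : measurableType d) (t : T -> R) (x y : T -> X) :
  measurable_fun setT t -> measurable_fun setT x -> measurable_fun setT y ->
  measurable_fun setT (fun z => kernel (t z) (x z) (y z)).
Proof.
move=> mt mx my; rewrite /kernel /heat_kernel.
apply: measurable_funM.
  apply: (@measurableT_comp _ _ _ _ _ _ (fun a : R => a `^ (- (N%:R / 2)))) => //.
  exact: measurable_funM.
apply: measurableT_comp => //; apply: measurableT_comp => //.
apply: measurable_funM; last first.
  apply: (@measurableT_comp _ _ _ _ _ _ (fun a : R => a^-1)).
    exact: measurable_invr.
  exact: measurable_funM.
apply: measurable_sum => i; apply: measurable_funX.
under eq_fun do rewrite !mxE.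
apply: measurable_funB.
- exact: (measurableT_comp (measurable_tnth i) mx).
- exact: (measurableT_comp (measurable_tnth i) my).
Qed.

Lemma measurable_kernelr t x : measurable_fun setT (kernel t x).
Proof. exact: measurable_kernel. Qed.

Lemma measurable_kernell t y : measurable_fun setT (kernel t ^~ y).
Proof. exact: measurable_kernel. Qed.

Lemma integrable_kernelr t x : 0 < t ->
  mu.-integrable setT (EFin \o kernel t x).
Proof.
move=> t0; apply/integrableP; split.
  by apply/measurable_EFinP; exact: measurable_kernelr.
under eq_integral do rewrite /= ger0_norm ?kernel_ge0//.
by rewrite integral_kernelr// ltry.
Qed.

(** The action of the heat semigroup at a time t > 0, on functions on the type
    that carries the measure. *)
Definition heat (t : R) (f : X -> R) (x : X) : R :=
  (\int[mu]_y (kernel t x y * f y))%R.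

Lemma heat_semigroupE (t : R) (f : 'rV[R]_N -> R) (x : X) : 0 < t ->
  heat_semigroup t f (rV_of_tuple x) = heat t (f \o @rV_of_tuple R N) x.
Proof. by move=> t0; rewrite /heat_semigroup gt_eqF. Qed.

End gaussian.

(** * The heat semigroup on measurable functions *)

Section heat_on_tuples.
Context {R : realType} {N : nat}.
Local Notation X := (N.-tuple R).
Local Notation mu := (@muN R N).
Local Notation leb := (@lebesgue_measure R).

Lemma integrable_prod_le d1 d2 (T1 : measurableType d1) (T2 : measurableType d2)
    (m1 : {sigma_finite_measure set T1 -> \bar R})
    (m2 : {sigma_finite_measure set T2 -> \bar R}) (f g : T1 * T2 -> R) :
  measurable_fun setT f -> measurable_fun setT g ->
  (forall z, `|f z| <= g z) ->
  (\int[m1]_x \int[m2]_y (g (x, y))%:E < +oo)%E ->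
  (m1 \x m2)%E.-integrable setT (EFin \o f).
Proof.
move=> mf mg fg gy; apply: (integrable_le mf _ fg).
have g0 z : 0 <= g z by exact: le_trans (fg z).
apply/integrable12ltyP; first exact/measurable_EFinP.
apply: le_lt_trans gy; rewrite le_eqVlt; apply/orP; left; apply/eqP.
apply: eq_integral => x _; apply: eq_integral => y _ /=.
by rewrite ger0_norm.
Qed.

Section bounded.
Variables (f : X -> R) (M : R).
Hypothesis mf : measurable_fun setT f.
Hypothesis fM : forall y, `|f y| <= M.

Lemma integrable_kernelM t x : 0 < t ->
  mu.-integrable setT (EFin \o (fun y => kernel t x y * f y)).
Proof.
move=> t0.
apply: (@integrable_le _ _ _ mu _ (fun y => M * kernel t x y)).
- by apply: measurable_funM => //; exact: measurable_kernelr.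
- under [X in integrable _ _ X]eq_fun do rewrite EFinM.
  by apply: integrableZl => //; exact: integrable_kernelr.
- move=> y; rewrite normrM ger0_norm ?kernel_ge0// mulrC ler_wpM2r//.
  exact: kernel_ge0.
Qed.

Lemma Rintegral_kernelr t x : 0 < t -> (\int[mu]_y kernel t x y)%R = 1.
Proof. by move=> t0; rewrite /Rintegral integral_kernelr. Qed.

Lemma heat_le t x : 0 < t -> `|heat t f x| <= M.
Proof.
move=> t0; apply: le_trans (le_normr_Rintegral _ (integrable_kernelM x t0)) _ => //.
have -> : M = (\int[mu]_y (M * kernel t x y))%R.
  by rewrite RintegralZl ?Rintegral_kernelr ?mulr1//; exact: integrable_kernelr.
apply: le_Rintegral => //.
- have := integrable_kernelM x t0; move=> /integrable_norm; exact.
- under [X in integrable _ _ X]eq_fun do rewrite EFinM.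
  by apply: integrableZl => //; exact: integrable_kernelr.
- move=> y _; rewrite normrM ger0_norm ?kernel_ge0// mulrC ler_wpM2r//.
  exact: kernel_ge0.
Qed.

End bounded.

Lemma measurable_heat d (T : measurableType d) (t : T -> R) (x : T -> X)
    (F : T * X -> R) :
  measurable_fun setT t -> measurable_fun setT x -> measurable_fun setT F ->
  measurable_fun setT (fun z => heat (t z) (fun y => F (z, y)) (x z)).
Proof.
move=> mt mx mF.
apply: (@measurable_fun_Rintegral _ _ _ _ _ mu
  (fun zy => kernel (t zy.1) (x zy.1) zy.2 * F zy)).
apply: measurable_funM => //; apply: measurable_kernel => //.
- exact: (measurableT_comp mt).
- exact: (measurableT_comp mx).
Qed.

(** Fubini's theorem, the kernel identity [integral_kernel_mul] being the inner
    integral. *)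
Lemma heat_heat (s t : R) (f : X -> R) (M : R) (a : X) : 0 < s -> 0 < t ->
  measurable_fun setT f ->
  (forall y, `|f y| <= M) -> heat s (heat t f) a = heat (s + t) f a.
Proof.
move=> s0 t0 mf fM.
have mk1 : measurable_fun setT (fun z : X * X => kernel s a z.1).
  exact: measurable_kernel.
have mk2 : measurable_fun setT (fun z : X * X => kernel t z.1 z.2).
  exact: measurable_kernel.
transitivity (\int[mu]_x (\int[mu]_y (kernel s a x * (kernel t x y * f y))))%R.
  apply: eq_Rintegral => x _; rewrite RintegralZl//.
  exact: integrable_kernelM fM _ _ _.
rewrite (@Rintegral_swap _ _ _ _ _ mu mu
  (fun z => kernel s a z.1 * (kernel t z.1 z.2 * f z.2))) /=.
  apply: eq_Rintegral => y _; under eq_Rintegral do rewrite mulrA.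
  rewrite RintegralZr//; first by rewrite /Rintegral integral_kernel_mul.
  apply/integrableP; split.
    apply/measurable_EFinP; apply: measurable_funM; first exact: measurable_kernelr.
    exact: measurable_kernell.
  rewrite [ltLHS](_ : _ = (kernel (s + t) a y)%:E) ?ltry//.
  rewrite -integral_kernel_mul//; apply: eq_integral => x _ /=.
  by rewrite ger0_norm// mulr_ge0 ?kernel_ge0.
apply: (@integrable_prod_le _ _ _ _ _ _ _
  (fun z => M * (kernel s a z.1 * kernel t z.1 z.2))).
- apply: measurable_funM => //; apply: measurable_funM => //.
  exact: (measurableT_comp mf).
- by apply: measurable_funM => //; exact: measurable_funM.
- move=> z; rewrite mulrA normrM ger0_norm; last by rewrite mulr_ge0 ?kernel_ge0.
  rewrite mulrC.
  by rewrite ler_wpM2r// mulr_ge0 ?kernel_ge0.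
have M0 : 0 <= M by exact: le_trans (fM a).
rewrite [ltLHS](_ : _ = \int[mu]_x (M%:E * (kernel s a x)%:E))%E.
  rewrite ge0_integralZl//.
  - by rewrite integral_kernelr// mule1 ltry.
  - by apply/measurable_EFinP; exact: measurable_kernelr.
  - by move=> x _; rewrite lee_fin kernel_ge0.
apply: eq_integral => x _ /=.
under eq_integral do rewrite mulrA EFinM.
rewrite ge0_integralZl//.
- by rewrite integral_kernelr// mule1.
- by apply/measurable_EFinP; exact: measurable_kernelr.
- by move=> y _; rewrite lee_fin kernel_ge0.
- by rewrite lee_fin mulr_ge0 ?kernel_ge0.
Qed.

Lemma heat0 (t : R) (x : X) : heat t (fun=> 0) x = 0.
Proof.
by rewrite /heat; under eq_Rintegral do rewrite mulr0; rewrite /Rintegral integral0.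
Qed.

(** The Duhamel integral of a source [k]. The restriction to times [s < t] is
    carried by [k] itself, so that all time integrals are over the real line; at
    times [t <= s] the kernel has a nonpositive time but the source vanishes. *)
Section source.
Variables (k : R * X -> R) (rho : R -> R) (t : R).
Hypothesis mk : measurable_fun setT k.
Hypothesis ir : leb.-integrable setT (EFin \o rho).
Hypothesis kr : forall s y, `|k (s, y)| <= rho s.
Hypothesis k0 : forall s y, t <= s -> k (s, y) = 0.

Let mks s : measurable_fun setT (fun y => k (s, y)).
Proof. exact: (measurableT_comp mk). Qed.

Let h (z : X * R) := heat (t - z.2) (fun y => k (z.2, y)) z.1.

Let mh : measurable_fun setT h.
Proof.
apply: (@measurable_heat _ _ (fun z : X * R => t - z.2) fst
  (fun w => k (w.1.2, w.2))) => //.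
  exact: measurable_funB.
apply: (measurableT_comp mk); apply: measurable_fun_pair => //.
exact: (measurableT_comp measurable_snd).
Qed.

Let hr z : `|h z| <= rho z.2.
Proof.
case: (ltP z.2 t) => zt; first by apply: heat_le => //; rewrite subr_gt0.
rewrite /h (_ : (fun y => _) = fun=> 0); last by apply/funext => y; exact: k0.
by rewrite heat0 normr0 (le_trans _ (kr _ z.1)).
Qed.

Lemma integrable_heat_source x :
  leb.-integrable setT (EFin \o (fun s => heat (t - s) (fun y => k (s, y)) x)).
Proof.
have mhx : measurable_fun setT (fun s => h (x, s)).
  exact: (measurableT_comp mh).
by apply: (@integrable_le _ _ (measurableTypeR R) leb _ rho) => // s; exact: (hr (x, s)).
Qed.

Lemma measurable_heat_duhamel :
  measurable_fun setT (fun x => (\int[leb]_s heat (t - s) (fun y => k (s, y)) x)%R).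
Proof. exact: (@measurable_fun_Rintegral R _ _ X (measurableTypeR R) leb h mh). Qed.

Lemma heat_duhamel_le x :
  `|(\int[leb]_s heat (t - s) (fun y => k (s, y)) x)%R| <= (\int[leb]_s rho s)%R.
Proof.
have ih := integrable_heat_source x.
apply: le_trans (le_normr_Rintegral _ ih) _ => //.
apply: le_Rintegral => //; first by move/integrable_norm : ih.
by move=> s _; exact: (hr (x, s)).
Qed.

(** The endpoint [s = t], where the semigroup is the identity instead of being
    given by the kernel, is a null set. *)
Lemma Rintegral_heat_source (F : R -> R) x :
  (forall s, 0 <= s < t -> F s = heat (t - s) (fun y => k (s, y)) x) ->
  (forall s y, s < 0 -> k (s, y) = 0) ->
  (\int[leb]_(s in `[0, t]) F s = \int[leb]_s heat (t - s) (fun y => k (s, y)) x)%R.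
Proof.
move=> FG kN0.
have eG : {in `[0, t[%classic, (fun s => heat (t - s) (fun y => k (s, y)) x) =1 F}.
  by move=> s; rewrite inE/= in_itv/= => /FG.
have iG : leb.-integrable `[0, t[
    (EFin \o (fun s => heat (t - s) (fun y => k (s, y)) x)).
  exact: integrableS (integrable_heat_source x).
rewrite -Rintegral_itv_bndo_bndc; last first.
  by apply: eq_integrable iG => // s st /=; rewrite eG.
rewrite -(eq_Rintegral leb eG) Rintegral_indicM; apply: eq_Rintegral => s _.
rewrite indicE; case: (boolP (s \in _)) => [|/negP st]; first by rewrite mul1r.
rewrite mul0r (_ : (fun y => _) = fun=> 0) ?heat0//; apply/funext => y.
case: (ltP s 0) => s0; first exact: kN0.
case: (ltP s t) => ts; last exact: k0.
by exfalso; apply: st; rewrite inE/= in_itv/= s0.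
Qed.

(** The semigroup property under the time integral. Fubini's theorem applies
    because the kernel is a probability density in space and [rho] is integrable
    in time. *)
Lemma heat_duhamel (T : R) (a : X) : t < T ->
  heat (T - t) (fun x => (\int[leb]_s heat (t - s) (fun y => k (s, y)) x)%R) a =
  (\int[leb]_s heat (T - s) (fun y => k (s, y)) a)%R.
Proof.
move=> tT; have Tt : 0 < T - t by rewrite subr_gt0.
have r0 s : 0 <= rho s by exact: le_trans (kr s a).
transitivity (\int[mu]_x (\int[leb]_s (kernel (T - t) a x * h (x, s))))%R.
  apply: eq_Rintegral => x _; rewrite RintegralZl//.
  exact: integrable_heat_source.
rewrite (@Rintegral_swap _ _ _ _ _ mu leb (fun z => kernel (T - t) a z.1 * h z)).
  apply: eq_Rintegral => s _; rewrite /h /=.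
  case: (ltP s t) => st.
    rewrite -[LHS]/(heat (T - t) (heat (t - s) (fun y => k (s, y))) a).
    have ts0 : 0 < t - s by rewrite subr_gt0.
    rewrite (heat_heat _ Tt ts0 (mks s) (kr s)).
    by rewrite addrA subrK.
  rewrite (_ : (fun y => k (s, y)) = fun=> 0).
    by rewrite heat0; under eq_Rintegral do rewrite heat0; exact: heat0.
  by apply/funext => y; exact: k0.
have mr : measurable_fun setT rho.
  by case/integrableP : ir => /measurable_EFinP.
apply: (@integrable_prod_le _ _ _ _ mu leb
  (fun z => kernel (T - t) a z.1 * h z) (fun z => kernel (T - t) a z.1 * rho z.2)).
- by apply: measurable_funM => //; exact: measurable_kernel.
- apply: measurable_funM; first exact: measurable_kernel.
  exact: (measurableT_comp mr).
- move=> z; rewrite normrM ger0_norm ?kernel_ge0//.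
  by rewrite ler_wpM2l ?kernel_ge0.
case/integrableP : ir => _; under eq_integral do rewrite /= ger0_norm//.
move=> iry; rewrite [ltLHS](_ : _ =
    \int[mu]_x ((kernel (T - t) a x)%:E * \int[leb]_s (rho s)%:E))%E.
  rewrite ge0_integralZr//.
  - by rewrite integral_kernelr// mul1e.
  - by apply/measurable_EFinP; exact: measurable_kernelr.
  - by move=> x _; rewrite lee_fin kernel_ge0.
  - by apply: integral_ge0 => s _; rewrite lee_fin.
apply: eq_integral => x _ /=; under eq_integral do rewrite EFinM.
rewrite ge0_integralZl//.
- exact/measurable_EFinP.
- by move=> s _; rewrite lee_fin.
- by rewrite lee_fin kernel_ge0.
Qed.

End source.

End heat_on_tuples.

(** * Measurability and bounds for continuous curves in C_0 *)

Section regularity.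
Context {R : realType} {N : nat}.
Local Notation X := (N.-tuple R).
Local Notation RN := 'rV[R]_N.

(** The left end of the cell containing [t] in the grid of mesh [n.+1%:R^-1]. *)
Definition grid (n : nat) (t : R) : R :=
  (Num.floor (n.+1%:R * t))%:~R / n.+1%:R.

Lemma grid_cvg t : grid ^~ t @ \oo --> t.
Proof.
apply: (@squeeze_cvgr _ _ _ _ (fun n => t - n.+1%:R^-1) (fun=> t)).
- apply: nearW => n; have /andP[f1 f2] := floor_itv (n.+1%:R * t).
  have n0 : 0 < n.+1%:R :> R by [].
  rewrite /grid; apply/andP; split; last first.
    by rewrite ler_pdivrMr// (le_trans f1)// mulrC.
  rewrite ler_pdivlMr// mulrBl mulVf ?gt_eqF// lerBlDr ltW//.
  by rewrite mulrC (lt_le_trans f2)// intrD.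
- rewrite -[X in _ --> X]subr0; apply: cvgB; first exact: cvg_cst.
  exact: cvg_harmonic.
- exact: cvg_cst.
Qed.

Lemma measurable_floor_fiber (c : R) (m : int) :
  measurable [set t : R | Num.floor (c * t) = m].
Proof.
rewrite (_ : [set t | _] = setT `&` (fun t => c * t) @^-1` `[m%:~R, (m + 1)%:~R[%classic).
  exact: mulrl_measurable.
apply/seteqP; split => t /=.
  by move/eqP; rewrite floor_eq in_itv.
by case=> _; rewrite in_itv/= -floor_eq => /eqP.
Qed.

(** The topology lives on row vectors and the sigma-algebra on tuples; they are
    related by writing [f] as the pointwise limit of functions that are constant on
    the cells of a grid. *)
Lemma measurable_comp_rV_of_tuple (f : RN -> R) : continuous f ->
  measurable_fun setT (f \o @rV_of_tuple R N).
Proof.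
move=> cf.
pose c n (x : X) : {ffun 'I_N -> int} := [ffun i => Num.floor (n.+1%:R * tnth x i)].
pose F n (z : {ffun 'I_N -> int}) (x : X) : R :=
  f (\row_(i < N) ((z i)%:~R / n.+1%:R)).
apply: (@measurable_fun_cvg _ _ _ _ (fun n x => F n (c n x) x)) => [n|x _].
  apply: measurable_countable_family => z; last exact: measurable_cst.
  rewrite (_ : _ @^-1` _ = \bigcap_(i in [set: 'I_N])
    ((fun x : X => tnth x i) @^-1` [set t | Num.floor (n.+1%:R * t) = z i])).
    apply: fin_bigcap_measurable => // i _; rewrite -[X in measurable X]setTI.
    by apply: measurable_tnth => //; exact: measurable_floor_fiber.
  apply/seteqP; split => x /=; first by move=> <- i _ /=; rewrite ffunE.
  by move=> h; apply/ffunP => i; rewrite ffunE; exact: (h i I).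
pose r n : RN := \row_(i < N) ((c n x i)%:~R / n.+1%:R).
suff rx : r @ \oo --> rV_of_tuple x by exact: (cvg_comp _ _ rx (cf _)).
apply/cvg_ballP => e e0.
have : forall i : 'I_N, \forall n \near \oo, ball (tnth x i) e (grid n (tnth x i)).
  by move=> i; have /cvg_ballP := @grid_cvg (tnth x i); exact.
move/filter_forall; apply: filterS => n xn.
by split=> // i j; rewrite !mxE ffunE; exact: xn.
Qed.

Lemma C0_RN_bounded (f : RN -> R) : C0_RN f -> exists M, forall x, `|f x| <= M.
Proof.
move=> [cf f0]; have [M fM] := f0 1 ltr01.
have K : compact [set v : RN | forall i, `[- M, M]%classic (v ord0 i)].
  by apply: (@rV_compact R N (fun=> `[- M, M]%classic)) => _; exact: segment_compact.
have : compact (f @` [set v : RN | forall i, `[- M, M]%classic (v ord0 i)]).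
  by apply: continuous_compact => //; exact: continuous_subspaceT.
move=> /compact_bounded[B [_ fB]].
exists (Num.max 1 (B + 1)) => x; rewrite le_max; apply/orP.
have [xM|xM] := ltP M `|x|; [by left; exact/ltW/fM|right].
apply: (fB (B + 1)); first by rewrite ltrDl.
exists x => // j /=; rewrite in_itv/= -ler_norml (le_trans _ xM)//.
rewrite [leRHS]/Num.Def.normr/= mx_normrE.
exact: (le_bigmax _ _ (ord0, j)).
Qed.

Section curve.
Variables (T : R) (u : R -> RN -> R).
Hypothesis uC : C_in_C0 T u.

Lemma C_in_C0_near s : s \in `[0, T] -> forall e, 0 < e ->
  \forall t \near s, t \in `[0, T] -> forall x, `|u s x - u t x| < e.
Proof.
move=> sT e e0; case: uC => _ /subspace_continuousP /(_ s sT) us.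
have /us : nbhs (u s : {uniform RN -> R}) [set h | forall x, `|u s x - h x| < e].
  apply/uniform_nbhs; exists [set z : R * R | ball z.1 e z.2]; split.
    by rewrite -entourage_ballE; exists e.
  by move=> h /= hB x; exact: hB.
by [].
Qed.

(** Each [u s] is bounded, and nearby times are uniformly close; compactness of
    the time interval makes the bound uniform. *)
Lemma C_in_C0_bounded : exists M, forall s x, s \in `[0, T] -> `|u s x| <= M.
Proof.
have /compact_near_coveringP cov := @segment_compact R 0 T.
have := cov _ (+oo : set_system R) (fun M s => s \in `[0, T] -> forall x, `|u s x| <= M) _.
case=> [s sT|M [_ uM]]; last first.
  by exists (M + 1) => s x sT; apply: uM => //; rewrite ltrDl.
have [/(_ s sT)/C0_RN_bounded[B uB] _] := uC.
have us := C_in_C0_near sT ltr01.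
near=> t M => tT x.
have : `|u s x - u t x| < 1 by apply: (near us t).
have := uB x; have : B + 1 <= M by near: M; apply: nbhs_pinfty_ge; exact: num_real.
move=> h1 h2 h3; rewrite (_ : u t x = u s x - (u s x - u t x)); last by ring.
by rewrite (le_trans (ler_normB _ _))// (le_trans _ h1)// lerD// ltW.
Unshelve. all: by end_near. Qed.

Hypothesis T0 : 0 <= T.

(** Composition with [clamp] extends a curve to all times, which makes it
    measurable on the whole product of time and space. *)
Definition clamp (s : R) : R := Num.min (Num.max s 0) T.

Lemma clamp_in s : clamp s \in `[0, T].
Proof. by rewrite in_itv/= le_min le_max lexx orbT T0 ge_min lexx orbT. Qed.

Lemma clampE s : s \in `[0, T] -> clamp s = s.
Proof. by rewrite in_itv/= => /andP[s0 sT]; rewrite /clamp max_l// min_l. Qed.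

Lemma continuous_clamp : continuous clamp.
Proof.
move=> s; apply: (@continuous_min R R (fun r => Num.max r 0) (fun=> T)).
  apply: (@continuous_max R R id (fun=> 0)); first exact: cvg_id.
  exact: cvg_cst.
exact: cvg_cst.
Qed.

(** A function continuous in time and measurable in space is a limit of
    functions that are piecewise constant in time. *)
Lemma measurable_clamp_curve :
  measurable_fun setT (fun z : R * X => u (clamp z.1) (rV_of_tuple z.2)).
Proof.
apply: (@measurable_fun_cvg _ _ _ _ (fun n (z : R * X) =>
  u (clamp (grid n z.1)) (rV_of_tuple z.2))) => [n|[s y] _ /=].
  apply: (@measurable_countable_family _ _ _ _
    (fun z : R * X => Num.floor (n.+1%:R * z.1))
    (fun m z => u (clamp (m%:~R / n.+1%:R)) (rV_of_tuple z.2))) => m.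
    rewrite (_ : _ @^-1` _ = setT `&` fst @^-1` [set t | Num.floor (n.+1%:R * t) = m]).
      by apply: measurable_fst => //; exact: measurable_floor_fiber.
    by rewrite setTI.
  apply: (@measurableT_comp _ _ _ _ _ _ (u _ \o @rV_of_tuple R N)) => //.
  apply: measurable_comp_rV_of_tuple.
  by have [/(_ _ (clamp_in (m%:~R / n.+1%:R)))[]] := uC.
apply/cvgrPdist_lt => e e0.
have us := C_in_C0_near (clamp_in s) e0.
have cg : clamp (grid n s) @[n --> \oo] --> clamp s.
  by apply: continuous_cvg; [exact: continuous_clamp|exact: grid_cvg].
have := cg _ us; rewrite /nbhs/=; apply: filterS => n /= usn.
by apply: usn; exact: clamp_in.
Qed.

End curve.
End regularity.

(** * Powers of time, linearity of the heat semigroup *)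

Section sources.
Context {R : realType} {N : nat}.
Local Notation X := (N.-tuple R).
Local Notation leb := (@lebesgue_measure R).

(** The bound does not depend on [e], which lets [e] tend to 0 by monotone
    convergence. *)
Lemma integral_powR_le (a e B : R) : 0 < a -> 0 < e ->
  (\int[leb]_(s in `[e, B]) (a * s `^ (a - 1))%:E <= (B `^ a)%:E)%E.
Proof.
move=> a0 e0; have [Be|eB] := leP B e.
  have [->|Be'] := eqVneq B e.
    by rewrite set_itv1 integral_set1 lee_fin powR_ge0.
  rewrite set_itv_ge ?bnd_simp -?ltNge ?lt_neqAle ?Be' ?Be//.
  by rewrite integral_set0 lee_fin powR_ge0.
have dp (r x : R) : 0 < x -> derivable (@powR R ^~ r) x 1.
  by move=> x0; apply: derivable_powR; rewrite in_itv/= x0.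
have cp (r x : R) : 0 < x -> {for x, continuous (@powR R ^~ r)}.
  move=> x0; apply: differentiable_continuous.
  exact/derivable1_diffP/dp.
rewrite (@continuous_FTC2 _ _ (@powR R ^~ a))//.
- by rewrite -EFinB lee_fin lerBlDr lerDl powR_ge0.
- apply: continuous_in_subspaceT => x; rewrite inE/= in_itv/= => /andP[ex _].
  apply: cvgM; first exact: cvg_cst.
  by apply: (cp (a - 1)); exact: lt_le_trans ex.
- split.
  + by move=> x; rewrite in_itv/= => /andP[ex _]; apply: dp; exact: lt_trans ex.
  + by apply: cvg_at_right_filter; exact: cp.
  + by apply: cvg_at_left_filter; apply: cp; exact: lt_trans eB.
- move=> x; rewrite in_itv/= => /andP[ex _]; rewrite powR_derive1// in_itv/=.
  by rewrite (lt_trans e0 ex).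
Qed.

(** Near 0 this is an improper integral, convergent because [a + 1] is positive. *)
Lemma integrable_powR (a B : R) : -1 < a ->
  leb.-integrable `[0, B] (EFin \o (fun s : R => s `^ a)).
Proof.
move=> aN1; have a1 : 0 < a + 1 by rewrite -ltrBlDr sub0r.
have mp : measurable_fun setT (fun s : R => s `^ a) by exact: measurable_powR.
have mpa : measurable_fun [set: measurableTypeR R]
    (abse \o (EFin \o (fun s : R => s `^ a))).
  by apply: measurableT_comp => //; exact/measurable_EFinP.
apply/integrableP; split; first exact/measurable_EFinP/measurable_funTS.
rewrite -integral_itv_obnd_cbnd; last first.
  exact: measurable_funTS mpa.
pose F (n : nat) := `[n.+1%:R^-1, B]%classic : set R.
have -> : `]0, B]%classic = \bigcup_n F n.
  apply/seteqP; split => s /=; rewrite /F.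
    rewrite in_itv/= => /andP[s0 sB].
    exists (Num.truncn s^-1) => //=; rewrite in_itv/= sB andbT.
    by rewrite invf_ple ?posrE// ltW// truncnS_gt.
  by case=> n _ /=; rewrite !in_itv/= => /andP[ns ->]; rewrite (lt_le_trans _ ns).
have : (\int[leb]_(s in \bigcup_i F i) `|(s `^ a)%:E| <=
    ((a + 1)^-1 * B `^ (a + 1))%:E)%E; last by move=> /le_lt_trans -> //; rewrite ltry.
have Fcvg : (\int[leb]_(x in F i) `|(x `^ a)%:E|)%E @[i --> \oo] -->
    (\int[leb]_(x in \bigcup_i F i) `|(x `^ a)%:E|)%E.
  apply: ge0_nondecreasing_set_cvg_integral => //.
  - move=> n m nm; apply/subsetPset => s; rewrite /F/= !in_itv/= => /andP[ns ->].
    by rewrite andbT (le_trans _ ns)// lef_pV2 ?posrE// ler_nat.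
  - by move=> n; exact: measurable_itv.
  - by move=> n; exact: measurable_funTS mpa.
rewrite -(cvg_lim _ Fcvg)//; apply: lime_le; first by apply: cvgP Fcvg.
apply: nearW => n.
rewrite (@eq_integral _ _ _ leb _ (fun s => ((a + 1)^-1%:E *
    ((a + 1) * s `^ (a + 1 - 1))%:E)%E)); last first.
  by move=> s _ /=; rewrite -EFinM ger0_norm ?powR_ge0// addrK mulKf ?gt_eqF.
rewrite ge0_integralZl//.
- by rewrite EFinM lee_pmul2l ?lte_fin ?invr_gt0// integral_powR_le// invr_gt0.
- exact: measurable_itv.
- apply/measurable_EFinP; apply: measurable_funTS; apply: measurable_funM => //.
- by move=> s _; rewrite lee_fin mulr_ge0 ?powR_ge0 ?ltW.
- by rewrite lee_fin invr_ge0 ltW.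
Qed.

Lemma heatZ (t c : R) (f : X -> R) (M : R) (x : X) : 0 < t -> measurable_fun setT f ->
  (forall y, `|f y| <= M) -> @heat R N t (fun y => c * f y) x = c * heat t f x.
Proof.
move=> t0 mf fM; rewrite /heat -RintegralZl//; last first.
  exact: integrable_kernelM fM _ _ _.
by apply: eq_Rintegral => y _; ring.
Qed.

Lemma heatD (t : R) (f g : X -> R) (M1 M2 : R) (x : X) : 0 < t -> measurable_fun setT f ->
  measurable_fun setT g ->
  (forall y, `|f y| <= M1) -> (forall y, `|g y| <= M2) ->
  @heat R N t (fun y => f y + g y) x = heat t f x + heat t g x.
Proof.
move=> t0 mf mg fM gM; rewrite /heat -RintegralD//.
- by apply: eq_Rintegral => y _; ring.
- exact: integrable_kernelM fM _ _ _.
- exact: integrable_kernelM gM _ _ _.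
Qed.
End sources.

(** * Pairing a mild solution with the backward heat kernel *)

Section pairing.
Context {R : realType} {N : nat}.
Local Notation X := (N.-tuple R).
Local Notation leb := (@lebesgue_measure R).
Local Notation RN := 'rV[R]_N.
Local Notation rV := (@rV_of_tuple R N).

Variables (al r B T : R) (f0 w : RN -> R) (g u : R -> RN -> R) (a : X).
Hypotheses (al_gtN1 : -1 < al) (B_gt0 : 0 < B) (BT : B < T) (r_ge0 : 0 <= r).
Hypotheses (f0_C0 : C0_RN f0) (w_C0 : C0_RN w) (g_C : C_in_C0 B g).
Hypothesis u_duhamel : forall (t : R) x, 0 <= t <= B -> u t x = duhamel al r f0 w g t x.

(** The nonlinear source at time [s], averaged by the backward heat kernel that
    concentrates at [a] at the final time [T]. *)
Definition source_pairing (s : R) : R :=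
  heat (T - s) (fun y => `|g (clamp B s) (rV y)| `^ r) a.

Definition forcing_pairing (s : R) : R := s `^ al * heat (T - s) (w \o rV) a.

Let B_ge0 : 0 <= B. Proof. exact: ltW. Qed.

Let mw : measurable_fun setT (w \o rV).
Proof. by apply: measurable_comp_rV_of_tuple; case: w_C0. Qed.

Let mf0 : measurable_fun setT (f0 \o rV).
Proof. by apply: measurable_comp_rV_of_tuple; case: f0_C0. Qed.

Let gr (z : R * X) := `|g (clamp B z.1) (rV z.2)| `^ r.

Let mgr : measurable_fun setT gr.
Proof.
apply: (@measurableT_comp _ _ _ _ _ _ (fun b : R => b `^ r)) => //.
apply: measurableT_comp => //; exact: measurable_clamp_curve g_C B_ge0.
Qed.

Let gr_bounded : exists M : R, forall z, `|gr z| <= M.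
Proof.
have [M gM] := C_in_C0_bounded g_C.
exists (M `^ r) => z; rewrite ger0_norm ?powR_ge0//.
have M0 : `|g (clamp B z.1) (rV z.2)| <= M by apply: gM; exact: clamp_in.
by rewrite ge0_ler_powR ?nnegrE// (le_trans _ M0).
Qed.

Lemma indicM_le (D E : set R) (c d s : R) : D `<=` E -> `|c| <= d ->
  `|\1_D s * c| <= \1_E s * d.
Proof.
move=> DE cd; rewrite normrM ger0_norm ?indic_ge0//.
rewrite !indicE; case: (boolP (s \in D)) => [sD|_].
  by rewrite mem_set ?mul1r//; apply: DE; exact: set_mem.
by rewrite mul0r mulr_ge0 ?(le_trans _ cd).
Qed.

Lemma integrable_indicM_cst (M : R) :
  leb.-integrable setT (EFin \o (fun s : R => \1_`[0, B] s * M)).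
Proof.
apply/(@integrable_indicM _ _ _ leb _ (fun=> M)) => //.
by apply: continuous_compact_integrable;
  [exact: segment_compact|apply: continuous_subspaceT => x; exact: cvg_cst].
Qed.

Lemma integrable_source_pairing : leb.-integrable `[0, B] (EFin \o source_pairing).
Proof.
have [M grM] := gr_bounded.
apply/(@integrable_indicM _ _ _ leb) => //.
apply: (@integrable_le _ _ (measurableTypeR R) leb _ (fun s => \1_`[0, B] s * M)).
- apply: measurable_funM => //.
  apply: (@measurable_heat R N _ (measurableTypeR R) (fun s => T - s) (fun=> a) gr) => //.
  exact: measurable_funB.
- exact: integrable_indicM_cst.
- move=> s; rewrite normrM ger0_norm ?indic_ge0// indicE.
  case: (boolP (s \in _)) => [|_]; last by rewrite !mul0r.
  rewrite inE/= in_itv/= => /andP[_ sB]; rewrite !mul1r.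
  apply: heat_le => [|y|]; last by rewrite subr_gt0 (le_lt_trans sB).
    exact: (@measurable_fun_pair2 _ _ _ _ _ _ gr s mgr).
  exact: (grM (s, y)).
Qed.

Lemma integrable_forcing_pairing : leb.-integrable `[0, B] (EFin \o forcing_pairing).
Proof.
have [M wM] := C0_RN_bounded w_C0.
apply/(@integrable_indicM _ _ _ leb) => //.
apply: (@integrable_le _ _ (measurableTypeR R) leb _
  (fun s => \1_`[0, B] s * (M * s `^ al))).
- apply: measurable_funM => //; apply: measurable_funM => //.
  apply: (@measurable_heat R N _ (measurableTypeR R) (fun s => T - s) (fun=> a) (fun z => w (rV z.2))) => //.
    exact: measurable_funB.
  exact: (measurableT_comp mw).
- apply/(@integrable_indicM _ _ _ leb _ (fun s => M * s `^ al)) => //.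
  under [X in integrable _ _ X]eq_fun do rewrite EFinM.
  by apply: integrableZl => //; exact: integrable_powR.
- move=> s; rewrite normrM ger0_norm ?indic_ge0// indicE.
  case: (boolP (s \in _)) => [|_]; last by rewrite !mul0r.
  rewrite inE/= in_itv/= => /andP[_ sB]; rewrite !mul1r /forcing_pairing.
  rewrite normrM ger0_norm ?powR_ge0// mulrC ler_wpM2r ?powR_ge0//.
  apply: heat_le => // [y|]; first exact: wM.
  by rewrite subr_gt0 (le_lt_trans sB).
Qed.

(** The Duhamel formula after application of S(T - t): by the semigroup property
    the kernel at time [s] has become G(T - s), which does not depend on [t].
    Therefore the left side is an integral function of [t], with a density free of
    the Laplacian. *)
Lemma mild_pairing (t : R) : 0 < t <= B ->
  heat (T - t) (u t \o rV) a = heat T (f0 \o rV) a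
  + (\int[leb]_(s in `[0, t[) source_pairing s)%R
  + (\int[leb]_(s in `[0, t[) forcing_pairing s)%R.
Proof.
move=> /andP[t0 tB]; have tT : t < T by exact: le_lt_trans BT.
have Tt : 0 < T - t by rewrite subr_gt0.
have tB' : (`[0, t[%classic : set R) `<=` `[0, B]%classic.
  by apply: subset_itvl; rewrite bnd_simp.
have [Mf f0M] := C0_RN_bounded f0_C0.
have [Mw wM] := C0_RN_bounded w_C0.
have [Mg grM] := gr_bounded.
pose k1 (z : R * X) := \1_`[0, t[ z.1 * gr z.
pose k2 (z : R * X) := \1_`[0, t[ z.1 * (z.1 `^ al * w (rV z.2)).
pose r1 (s : R) := \1_`[0, B] s * Mg.
pose r2 (s : R) := \1_`[0, B] s * (Mw * s `^ al).
have mi : measurable_fun [set: R * X] (fun z => \1_`[0, t[ z.1 : R).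
  by apply: (@measurableT_comp _ _ _ _ _ _ (\1_`[0, t[ : R -> R)).
have mk1 : measurable_fun setT k1 by exact: measurable_funM.
have mk2 : measurable_fun setT k2.
  apply: measurable_funM => //; apply: measurable_funM.
    exact: (@measurableT_comp _ _ _ _ _ _ (fun b : R => b `^ al)).
  exact: (measurableT_comp mw).
have ir1 : leb.-integrable setT (EFin \o r1) by exact: integrable_indicM_cst.
have ir2 : leb.-integrable setT (EFin \o r2).
  apply/(@integrable_indicM _ _ _ leb _ (fun s => Mw * s `^ al)) => //.
  under [X in integrable _ _ X]eq_fun do rewrite EFinM.
  by apply: integrableZl => //; exact: integrable_powR.
have kr1 s y : `|k1 (s, y)| <= r1 s by exact: indicM_le (grM _).
have kr2 s y : `|k2 (s, y)| <= r2 s.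
  apply: indicM_le => //; rewrite normrM ger0_norm ?powR_ge0// mulrC.
  by rewrite ler_wpM2r ?powR_ge0.
have i0 (s : R) : ~ (0 <= s < t) -> \1_`[0, t[ s = 0 :> R.
  move=> st; rewrite indicE memNset//= in_itv/=; exact/negP.
have k10 s y : t <= s -> k1 (s, y) = 0.
  by move=> ts; rewrite /k1 i0 ?mul0r// => /andP[_]; rewrite ltNge ts.
have k20 s y : t <= s -> k2 (s, y) = 0.
  by move=> ts; rewrite /k2 i0 ?mul0r// => /andP[_]; rewrite ltNge ts.
have k1N (s : R) y : s < 0 -> k1 (s, y) = 0.
  by move=> ts; rewrite /k1 i0 ?mul0r// => /andP[+ _]; rewrite leNgt ts.
have k2N (s : R) y : s < 0 -> k2 (s, y) = 0.
  by move=> ts; rewrite /k2 i0 ?mul0r// => /andP[+ _]; rewrite leNgt ts.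
have i1 (s : R) : 0 <= s < t -> \1_`[0, t[ s = 1 :> R.
  by move=> st; rewrite indicE mem_set//= in_itv.
pose D1 x := (\int[leb]_s heat (t - s) (fun y => k1 (s, y)) x)%R.
pose D2 x := (\int[leb]_s heat (t - s) (fun y => k2 (s, y)) x)%R.
have uE : u t \o rV = (fun x => heat t (f0 \o rV) x + D1 x + D2 x).
  apply/funext => x /=; rewrite u_duhamel ?(ltW t0)// /duhamel.
  rewrite heat_semigroupE//; congr (_ + _ + _).
  - apply: (Rintegral_heat_source mk1 ir1 kr1 k10 _ k1N) => s st.
    have /andP[s0 st'] := st.
    rewrite heat_semigroupE ?subr_gt0//; congr (heat _ _ x).
    apply/funext => y; rewrite /k1 /gr /= i1// mul1r clampE//.
    by rewrite in_itv/= s0 (le_trans (ltW st')).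
  - apply: (Rintegral_heat_source mk2 ir2 kr2 k20 _ k2N) => s st.
    have /andP[s0 st'] := st.
    rewrite heat_semigroupE ?subr_gt0//.
    rewrite -(heatZ _ _ _ mw (fun y => wM (rV y))) ?subr_gt0//; congr (heat _ _ x).
    by apply/funext => y; rewrite /k2 /= i1// mul1r.
have mD1 : measurable_fun setT D1 by exact: measurable_heat_duhamel.
have mD2 : measurable_fun setT D2 by exact: measurable_heat_duhamel.
have D1M x := heat_duhamel_le mk1 ir1 kr1 k10 x.
have D2M x := heat_duhamel_le mk2 ir2 kr2 k20 x.
have mS : measurable_fun setT (heat t (f0 \o rV)).
  apply: (@measurable_heat _ _ _ _ (fun=> t) id (fun z => f0 (rV z.2))) => //.
  exact: (measurableT_comp mf0).
have SM x : `|heat t (f0 \o rV) x| <= Mf.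
  exact: (heat_le mf0 (fun y => f0M (rV y)) x t0).
have mSD : measurable_fun setT (fun x => heat t (f0 \o rV) x + D1 x).
  exact: measurable_funD mS mD1.
have SDM x : `|heat t (f0 \o rV) x + D1 x| <= Mf + (\int[leb]_s r1 s)%R.
  by rewrite (le_trans (ler_normD _ _))// lerD// D1M.
rewrite uE (heatD _ Tt mSD mD2 SDM D2M).
rewrite (heatD _ Tt mS mD1 SM D1M); congr (_ + _ + _).
- rewrite (@heat_heat _ _ _ _ _ Mf) ?subrK// => y; exact: f0M.
- rewrite /D1 (heat_duhamel mk1 ir1 kr1 k10 a tT) [RHS]Rintegral_indicM.
  apply: eq_Rintegral => s _; rewrite /k1 /=.
  have [/i1 ->|/negP/i0 ->] := boolP (0 <= s < t).
    by rewrite mul1r; congr (heat _ _ a); apply/funext => y; rewrite mul1r.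
  rewrite mul0r (_ : (fun y => _) = fun=> 0) ?heat0//; apply/funext => y.
  by rewrite mul0r.
- rewrite /D2 (heat_duhamel mk2 ir2 kr2 k20 a tT) [RHS]Rintegral_indicM.
  apply: eq_Rintegral => s _; rewrite /k2 /=.
  have [st|/negP/i0 ->] := boolP (0 <= s < t).
    rewrite i1// mul1r /forcing_pairing -(heatZ _ _ _ mw (fun y => wM (rV y))); last first.
      by rewrite subr_gt0 (lt_trans _ tT)//; case/andP: st.
    by congr (heat _ _ a); apply/funext => y; rewrite mul1r.
  rewrite mul0r (_ : (fun y => _) = fun=> 0) ?heat0//; apply/funext => y.
  by rewrite mul0r.
Qed.

End pairing.

(** * The time cutoff and Young's inequality *)

Section cutoff.
Context {R : realType}.
Local Notation leb := (@lebesgue_measure R).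
Implicit Types A B t s : R.

(** Normalized so that on the window it lies between 0 and 1 and its derivative
    is bounded by the inverse of the length. *)
Definition parabola A B t : R := (t - A) * (B - t) / (B - A) ^+ 2.

Definition parabola' A B t : R := ((B - t) - (t - A)) / (B - A) ^+ 2.

(** A high power is taken so that the derivative is controlled by a power of the
    cutoff that is close to 1, as Young's inequality requires. *)
Definition cutoff (m : nat) A B t : R := parabola A B t ^+ m.+1.

Definition cutoff' (m : nat) A B t : R :=
  m.+1%:R * parabola A B t ^+ m * parabola' A B t.

Lemma parabola_itv A B t : A < B -> t \in `[A, B] -> 0 <= parabola A B t <= 1.
Proof.
move=> AB; rewrite in_itv/= => /andP[At tB].
have L0 : 0 < B - A by rewrite subr_gt0.
apply/andP; split.
  by rewrite divr_ge0 ?sqr_ge0// mulr_ge0 ?subr_ge0.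
rewrite ler_pdivrMr ?exprn_gt0// mul1r expr2.
by apply: ler_pM; rewrite ?subr_ge0 ?lerB//.
Qed.

Lemma normr_parabola'_le A B t : A < B -> t \in `[A, B] ->
  `|parabola' A B t| <= (B - A)^-1.
Proof.
move=> AB; rewrite in_itv/= => /andP[At tB].
have L0 : 0 < B - A by rewrite subr_gt0.
rewrite /parabola' normrM [X in _ * X]ger0_norm ?invr_ge0 ?sqr_ge0//.
rewrite ler_pdivrMr ?exprn_gt0// expr2 mulKf ?gt_eqF// ler_norml.
by lra.
Qed.

Lemma is_derive_cutoff m A B t : is_derive t (1 : R) (cutoff m A B) (cutoff' m A B t).
Proof.
have h : is_derive t (1 : R) (parabola A B) (parabola' A B t).
  rewrite /parabola; apply: is_derive_eq.
  rewrite /parabola' /GRing.scale /=; ring.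
rewrite /cutoff -(exprfctE (parabola A B)).
exact: (is_deriveX m.+1 h).
Qed.

Lemma continuous_cutoff m A B : continuous (cutoff m A B).
Proof.
move=> t; apply: differentiable_continuous; apply/derivable1_diffP.
by have [] := is_derive_cutoff m A B t.
Qed.

Lemma continuous_cutoff' m A B : continuous (cutoff' m A B).
Proof.
have cB c : continuous (fun t : R => t - c).
  by move=> t; apply: cvgB; [exact: cvg_id|exact: cvg_cst].
have cN c : continuous (fun t : R => c - t).
  by move=> t; apply: cvgB; [exact: cvg_cst|exact: cvg_id].
have cp : continuous (parabola A B).
  move=> t; apply: (@cvgM _ _ _ _ (fun t => (t - A) * (B - t)) (fun=> _)).
    by apply: (@cvgM _ _ _ _ (fun t => t - A) (fun t => B - t)); [exact: cB|exact: cN].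
  exact: cvg_cst.
have cp' : continuous (parabola' A B).
  move=> t; apply: (@cvgM _ _ _ _ (fun t => (B - t) - (t - A)) (fun=> _)).
    by apply: (@cvgB _ _ _ _ _ (fun t => B - t) (fun t => t - A)); [exact: cN|exact: cB].
  exact: cvg_cst.
move=> t; apply: (@cvgM _ _ _ _ (fun t => m.+1%:R * parabola A B t ^+ m) (parabola' A B)).
  apply: (@cvgM _ _ _ _ (fun=> m.+1%:R) (fun t => parabola A B t ^+ m)).
    exact: cvg_cst.
  exact: (cvg_comp _ _ (cp t) (@exprn_continuous _ _ _)).
exact: cp'.
Qed.

Lemma cutoff_endl m A B : cutoff m A B A = 0.
Proof. by rewrite /cutoff /parabola subrr !mul0r expr0n. Qed.

Lemma cutoff_endr m A B : cutoff m A B B = 0.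
Proof. by rewrite /cutoff /parabola subrr mulr0 mul0r expr0n. Qed.

Lemma Rintegral_cutoff' m A B s : A < B -> s \in `[A, B] ->
  (\int[leb]_(t in `]s, B]) - cutoff' m A B t)%R = cutoff m A B s.
Proof.
move=> AB; rewrite in_itv/= => /andP[As]; rewrite le_eqVlt => /predU1P[->|sB].
  by rewrite set_itv_ge ?bnd_simp ?ltxx// Rintegral_set0 cutoff_endr.
rewrite /Rintegral integral_itv_obnd_cbnd; last first.
  apply/measurable_EFinP; apply: measurable_funTS.
  apply: continuous_measurable_fun => t; apply: continuousN.
  exact: continuous_cutoff'.
rewrite (@continuous_FTC2 _ _ (fun t => - cutoff m A B t))//=.
- by rewrite cutoff_endr oppr0 add0r opprK.
- apply: continuous_subspaceT => t; apply: continuousN.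
  exact: continuous_cutoff'.
- have cc t : {for t, continuous (fun t => - cutoff m A B t)}.
    by apply: continuousN; exact: continuous_cutoff.
  split.
  + by move=> t _; apply: derivableN; have [] := is_derive_cutoff m A B t.
  + by apply: cvg_at_right_filter; exact: cc.
  + by apply: cvg_at_left_filter; exact: cc.
- move=> t _; rewrite derive1E deriveN; last by have [] := is_derive_cutoff m A B t.
  by congr (- _); have [_ ->] := is_derive_cutoff m A B t.
Qed.

(** On the middle half of the window the parabola is at least 3/16; the constant 1/8
    is a convenient smaller value. *)
Lemma Rintegral_cutoff_ge m A B : A < B ->
  8^-1 ^+ m.+1 / 2 * (B - A) <= (\int[leb]_(t in `[A, B]) cutoff m A B t)%R.
Proof.
move=> AB; set c := 8^-1 ^+ m.+1.
pose E := (`[A + (B - A) / 4, B - (B - A) / 4])%classic : set R.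
have EJ : E `<=` `[A, B]%classic.
  by apply: subset_itv; rewrite bnd_simp; lra.
have mE : measurable E by exact: measurable_itv.
have EL : fine (leb E) = (B - A) / 2.
  rewrite lebesgue_measure_itv /= lte_fin ifT; first by rewrite /=; lra.
  by lra.
have -> : c / 2 * (B - A) = (\int[leb]_(t in E) c)%R.
  by rewrite Rintegral_cst// EL; ring.
rewrite [leLHS]Rintegral_indicM [leRHS]Rintegral_indicM; apply: le_Rintegral => //.
- apply/(@integrable_indicM _ _ _ leb _ (fun=> c)) => //.
  apply: continuous_compact_integrable; first exact: segment_compact.
  by apply: continuous_subspaceT => x; exact: cvg_cst.
- apply/(@integrable_indicM _ _ _ leb _ (cutoff m A B)) => //.
  apply: continuous_compact_integrable; first exact: segment_compact.
  by apply: continuous_subspaceT; exact: continuous_cutoff.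
move=> t _; have c0 : 0 <= c by rewrite exprn_ge0.
rewrite !indicE; case: (boolP (t \in E)) => [tE|_].
  rewrite mem_set ?mul1r; last by apply: EJ; exact: set_mem.
  have L0 : 0 < B - A by rewrite subr_gt0.
  have : t \in `[A + (B - A) / 4, B - (B - A) / 4] by exact: set_mem tE.
  rewrite in_itv/= => /andP[t1 t2].
  rewrite /c /cutoff lerXn2r ?nnegrE//; last first.
    rewrite ler_pdivlMr ?exprn_gt0// expr2.
    have := ler_pM _ _ (_ : (B - A) / 4 <= t - A) (_ : (B - A) / 4 <= B - t).
    nra.
  rewrite divr_ge0 ?sqr_ge0// mulr_ge0//; lra.
rewrite mul0r; case: (boolP (t \in _)) => [|_]; last by rewrite mul0r.
rewrite inE/= => /(parabola_itv AB)/andP[p0 _]; rewrite mul1r.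
exact: exprn_ge0.
Qed.

End cutoff.

Section young.
Context {R : realType}.

(** Here [z ^+ m.+1] is the cutoff and [z ^+ m] the size of its derivative. Young's
    inequality is applied to the factors lam^(1/q) z^m y and D lam^(-1/q); the
    assumption on [m] says that m q >= m + 1, so that z^(m q) is at most the cutoff
    and the source is absorbed with the right weight. *)
Lemma young_weighted (q lam D y z : R) (m : nat) : 1 < q -> 0 < lam -> 0 <= D ->
  0 <= y -> 0 <= z <= 1 -> 1 <= m%:R * (q - 1) ->
  D * z ^+ m * y <= lam * z ^+ m.+1 * y `^ q
    + D `^ (q / (q - 1)) * lam `^ (- (q - 1)^-1).
Proof.
move=> q1 l0 D0 y0 /andP[z0 z1] mq.
have q0 : 0 < q by exact: lt_trans q1.
have qm0 : 0 < q - 1 by rewrite subr_gt0.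
have q'0 : 0 < q / (q - 1) by rewrite divr_gt0.
have zm : 0 <= z ^+ m by exact: exprn_ge0.
have -> : D * z ^+ m * y = (lam `^ q^-1 * (z ^+ m * y)) * (D * lam `^ (- q^-1)).
  have : lam `^ q^-1 * lam `^ (- q^-1) = 1.
    by rewrite powRN divff// gt_eqF// powR_gt0.
  move=> e; rewrite [RHS](_ : _ = D * z ^+ m * y * (lam `^ q^-1 * lam `^ (- q^-1))).
    by rewrite e mulr1.
  by ring.
have A0 : 0 <= lam `^ q^-1 * (z ^+ m * y) by rewrite !mulr_ge0 ?powR_ge0.
have B0 : 0 <= D * lam `^ (- q^-1) by rewrite mulr_ge0 ?powR_ge0.
apply: le_trans (conjugate_powR A0 B0 q0 q'0 _) _.
  by field; rewrite gt_eqF// gt_eqF.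
apply: lerD.
- apply: le_trans (_ : (lam `^ q^-1 * (z ^+ m * y)) `^ q <= _).
    by rewrite ler_pdivrMr// ler_peMr ?powR_ge0// ltW.
  rewrite powRM ?powR_ge0 ?mulr_ge0// powRM// -powRrM mulVf ?gt_eqF//.
  rewrite powRr1 ?(ltW l0)// mulrA ler_wpM2r ?powR_ge0// ler_wpM2l ?(ltW l0)//.
  have [->|zn0] := eqVneq z 0.
    rewrite exprS mul0r expr0n; case: m mq {zm A0} => [|m _] /=.
      by rewrite mul0r ler10.
    by rewrite powR0 ?gt_eqF.
  have zp : 0 < z by rewrite lt_neqAle eq_sym zn0.
  rewrite -!powR_mulrn// -powRrM; apply: ger_powR; first by rewrite zp.
  by move: mq; rewrite mulrBr mulr1 lerBrDl -natr1.
- rewrite powRM ?powR_ge0// -powRrM.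
  rewrite (_ : - q^-1 * (q / (q - 1)) = - (q - 1)^-1); last first.
    by field; rewrite !gt_eqF.
  rewrite ler_pdivrMr// ler_peMr ?mulr_ge0 ?powR_ge0//.
  by rewrite ler_pdivlMr// mul1r; lra.
Qed.

End young.

(** * Testing in time *)

Section triangle.
Context {R : realType}.
Local Notation leb := (@lebesgue_measure R).

(** Exchange of integrals on a triangle: integration by parts for an integral
    function whose density is merely integrable. *)
Lemma Rintegral_triangle (A B C : R) (th eta h : R -> R) : 0 <= A -> A <= B ->
  measurable_fun setT th -> (forall t, t \in `[A, B] -> `|th t| <= C) ->
  leb.-integrable `[0, B] (EFin \o h) ->
  (forall s, s \in `[A, B] -> (\int[leb]_(t in `]s, B]) th t)%R = eta s) ->
  eta A = 0 ->
  (\int[leb]_(t in `[A, B]) (th t * \int[leb]_(s in `[0, t[) h s))%R =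
  (\int[leb]_(s in `[A, B]) (eta s * h s))%R.
Proof.
move=> A0 AB mth thC ih eth etaA.
have C0 : 0 <= C.
  by rewrite (le_trans _ (thC A _))// in_itv/= lexx.
pose H s := \1_`[0, B] s * h s.
pose Th t := \1_`[A, B] t * th t.
have iH : leb.-integrable setT (EFin \o H) 
  by apply/(@integrable_indicM _ _ _ leb _ h).
have mH : measurable_fun setT H.
  by case/integrableP : iH => /measurable_EFinP.
have mTh : measurable_fun setT Th by exact: measurable_funM.
pose lt01 (z : R * R) : R := if z.2 < z.1 then 1 else 0.
have mlt : measurable_fun setT lt01.
  apply: measurable_fun_ifT => //.
  exact: measurable_fun_ltr.
have lt01_le z : `|lt01 z| <= 1.
  by rewrite /lt01; case: ifP; rewrite ?normr1 ?normr0.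
pose f (z : R * R) := Th z.1 * (H z.2 * lt01 z).
have mf : measurable_fun setT f.
  apply: measurable_funM; first exact: (measurableT_comp mTh).
  by apply: measurable_funM => //; exact: (measurableT_comp mH).
have ThC t : `|Th t| <= \1_`[A, B] t * C.
  rewrite /Th normrM ger0_norm ?indic_ge0// indicE.
  case: (boolP (t \in _)) => [|_]; last by rewrite !mul0r.
  by rewrite inE/= => tJ; rewrite !mul1r thC.
have iC : leb.-integrable setT (EFin \o (fun t : R => \1_`[A, B] t * C)).
  apply/(@integrable_indicM _ _ _ leb _ (fun=> C)) => //.
  apply: continuous_compact_integrable; first exact: segment_compact.
  by apply: continuous_subspaceT => x; exact: cvg_cst.
have iTh : leb.-integrable setT (EFin \o Th) by exact: integrable_le iC ThC.
have iHlt t : leb.-integrable setT (EFin \o (fun s => H s * lt01 (t, s))).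
  apply: (@integrable_le _ _ (measurableTypeR R) leb _ (fun s => `|H s|)).
  - by apply: measurable_funM => //; exact: (@measurable_fun_pair2 _ _ _ _ _ _ lt01 t).
  - by move/integrable_norm : iH.
  - by move=> s; rewrite normrM ler_piMr.
have iThlt s : leb.-integrable setT (EFin \o (fun t => Th t * lt01 (t, s))).
  apply: (@integrable_le _ _ (measurableTypeR R) leb _ (fun t => `|Th t|)).
  - by apply: measurable_funM => //; exact: (@measurable_fun_pair1 _ _ _ _ _ _ lt01 s).
  - by move/integrable_norm : iTh.
  - by move=> t; rewrite normrM ler_piMr.
transitivity (\int[leb]_t (\int[leb]_s f (t, s)))%R.
  rewrite [LHS]Rintegral_indicM; apply: eq_Rintegral => t _.
  rewrite mulrA -/(Th t) /f /= RintegralZl//.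
  have [|tJ] := boolP (t \in `[A, B]); last first.
    by rewrite /Th indicE memNset ?mul0r//; exact/negP.
  rewrite in_itv/= => /andP[At tB]; congr (_ * _).
  rewrite [LHS]Rintegral_indicM; apply: eq_Rintegral => s _.
  rewrite /H /lt01 /= !indicE !mem_setE !in_itv/=.
  case: (leP 0 s) => s0 /=; last by rewrite !mul0r.
  case: (ltP s t) => st /=; last by rewrite mul0r mulr0.
  by rewrite (le_trans (ltW st) tB) mulr1.
rewrite (@Rintegral_swap _ _ _ (measurableTypeR R) (measurableTypeR R) leb leb f); last first.
  apply: (@integrable_prod_le _ _ _ (measurableTypeR R) (measurableTypeR R) leb leb f
    (fun z => (\1_`[A, B] z.1 * C) * `|H z.2|)) => //.
  - apply: measurable_funM.
      apply: measurable_funM => //.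
      exact: (@measurableT_comp _ _ _ _ _ _ (\1_`[A, B] : R -> R)).
    by apply: measurableT_comp => //; exact: (measurableT_comp mH).
  - move=> z; rewrite /f normrM; apply: ler_pM => //.
    by rewrite normrM ler_piMr.
  - case/integrableP : iH => _ /= iHy.
    rewrite [ltLHS](_ : _ = \int[leb]_t ((\1_`[A, B] t * C)%:E *
        \int[leb]_s `|(H s)%:E|))%E; last first.
      apply: eq_integral => t _ /=; under eq_integral do rewrite EFinM.
      rewrite ge0_integralZl//.
      + by apply/measurable_EFinP; apply: measurableT_comp.
      + by rewrite lee_fin mulr_ge0.
    case/integrableP : iC => mC; under eq_integral do rewrite /= ger0_norm ?mulr_ge0//.
    move=> iCy; rewrite ge0_integralZr//.
    + have I0 : (0 <= \int[leb]_t (\1_`[A, B] t * C)%:E)%E.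
        by apply: integral_ge0 => t _; rewrite lee_fin mulr_ge0.
      by apply: lte_mul_pinfty => //; rewrite ge0_fin_numE.
    + by move=> t _; rewrite lee_fin mulr_ge0.
    + exact: integral_ge0.
rewrite [RHS]Rintegral_indicM; apply: eq_Rintegral => s _.
transitivity (H s * (\int[leb]_t (Th t * lt01 (t, s))))%R.
  rewrite -RintegralZl//; apply: eq_Rintegral => t _; rewrite /f /=; ring.
have [s0B|s0B] := boolP (s \in `[0, B]); last first.
  rewrite /H !indicE !mem_setE (negbTE s0B) (_ : (s \in `[A, B]) = false) ?mul0r//.
  apply/negP; rewrite in_itv/= => /andP[As sB]; move: s0B; rewrite in_itv/= sB andbT.
  by rewrite (le_trans A0 As).
rewrite {1}/H indicE mem_setE s0B mul1r.
move: s0B; rewrite in_itv/= => /andP[s0 sB].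
have [As|sA] := leP A s.
  rewrite indicE mem_setE in_itv/= As sB mul1r mulrC; congr (_ * _).
  rewrite -eth ?in_itv/= ?As//  [RHS]Rintegral_indicM; apply: eq_Rintegral => t _.
  rewrite /Th /lt01 /= !indicE !mem_setE !in_itv/=.
  case: (ltP s t) => st /=; last by rewrite !(mul0r, mulr0).
  by rewrite (le_trans As (ltW st)) mulr1.
rewrite indicE mem_setE in_itv/= leNgt sA/= mul0r.
rewrite (_ : (\int[leb]_t (Th t * lt01 (t, s)))%R = eta A) ?etaA ?mulr0//.
rewrite -etaA -eth ?in_itv/= ?lexx// Rintegral_itv_obnd_cbnd; last first.
  apply/(@integrable_indicM _ _ _ leb _ th) => //.
  apply: integrable_le iC _ => // [|t].
    by apply: measurable_funM.
  rewrite normrM ger0_norm ?indic_ge0// !indicE !mem_setE.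
  case: (boolP (t \in `]A, B])) => [tJ|_]; last by rewrite mul0r mulr_ge0.
  have tJ' : t \in `[A, B] by exact: subset_itv_oc_cc tJ.
  by rewrite tJ' !mul1r thC.
rewrite [RHS]Rintegral_indicM; apply: eq_Rintegral => t _.
rewrite /Th /lt01 /= !indicE !mem_setE !in_itv/=.
case: (leP A t) => At /=; last by rewrite !mul0r.
by rewrite (lt_le_trans sA At) mulr1.
Qed.

End triangle.

(** * The tested inequality for one equation *)

Section component.
Context {R : realType} {N : nat}.
Local Notation X := (N.-tuple R).
Local Notation leb := (@lebesgue_measure R).
Local Notation RN := 'rV[R]_N.
Local Notation rV := (@rV_of_tuple R N).

Lemma ler_heat (t : R) (f1 f2 : X -> R) (M1 M2 : R) (x : X) : 0 < t ->
  measurable_fun setT f1 -> measurable_fun setT f2 ->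
  (forall y, `|f1 y| <= M1) -> (forall y, `|f2 y| <= M2) ->
  (forall y, f1 y <= f2 y) -> heat t f1 x <= heat t f2 x.
Proof.
move=> t0 mf1 mf2 fM1 fM2 f12; apply: le_Rintegral => //.
- exact: integrable_kernelM fM1 _ _ _.
- exact: integrable_kernelM fM2 _ _ _.
- by move=> y _; rewrite ler_wpM2l ?kernel_ge0.
Qed.

Lemma ler_norm_heat (t : R) (f : X -> R) (M : R) (x : X) : 0 < t ->
  measurable_fun setT f -> (forall y, `|f y| <= M) ->
  `|heat t f x| <= heat t (fun y => `|f y|) x.
Proof.
move=> t0 mf fM.
have := le_normr_Rintegral _ (integrable_kernelM mf fM x t0) => /(_ measurableT).
move/le_trans; apply; rewrite le_eqVlt; apply/orP; left; apply/eqP.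
by apply: eq_Rintegral => y _; rewrite normrM ger0_norm ?kernel_ge0.
Qed.

Lemma heat_cst (t c : R) (x : X) : 0 < t -> heat t (fun=> c) x = c.
Proof.
move=> t0; rewrite /heat RintegralZr//; last exact: integrable_kernelr.
by rewrite Rintegral_kernelr// mul1r.
Qed.

Lemma integrable_bounded_itv (A B M : R) (f : R -> R) :
  measurable_fun setT f -> (forall t, t \in `[A, B] -> `|f t| <= M) ->
  leb.-integrable `[A, B] (EFin \o f).
Proof.
move=> mf fM; apply/(@integrable_indicM _ _ _ leb) => //.
apply: (@integrable_le _ _ (measurableTypeR R) leb _ (fun t => \1_`[A, B] t * `|M|)).
- exact: measurable_funM.
- apply/(@integrable_indicM _ _ _ leb _ (fun=> `|M|)) => //.
  apply: continuous_compact_integrable; first exact: segment_compact.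
  by apply: continuous_subspaceT => x; exact: cvg_cst.
- move=> t; rewrite normrM ger0_norm ?indic_ge0// indicE mem_setE.
  case: (boolP (t \in _)) => [tJ|_]; last by rewrite !mul0r.
  by rewrite !mul1r (le_trans (fM t tJ))// ler_norm.
Qed.

Variables (al p q A L lam delta wmin : R) (m : nat).
Variables (f0 w : RN -> R) (g u : R -> RN -> R) (a : X).
Let B := A + L.
Let T := A + L *+ 2.
Hypotheses (al_gtN1 : -1 < al) (p_gt1 : 1 < p) (q_gt1 : 1 < q).
Hypotheses (A_gt0 : 0 < A) (L_gt0 : 0 < L) (lam_gt0 : 0 < lam).
Hypothesis mq : 1 <= m%:R * (q - 1).
Hypotheses (f0_C0 : C0_RN f0) (w_C0 : C0_RN w).
Hypotheses (g_C : C_in_C0 B g) (u_C : C_in_C0 B u).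
Hypothesis u_duhamel :
  forall (t : R) x, 0 <= t <= B -> u t x = duhamel al p f0 w g t x.
Hypothesis delta_ge0 : 0 <= delta.
Hypothesis w_pairing : forall t, L <= t <= L *+ 2 -> delta <= heat t (w \o rV) a.
Hypothesis wmin_ge0 : 0 <= wmin.
Hypothesis wmin_le : forall s, s \in `[A, B] -> wmin <= s `^ al.

Definition tested_source (r : R) (h : R -> RN -> R) : R :=
  (\int[leb]_(s in `[A, B]) (cutoff m A B s * source_pairing r B T h a s))%R.

Let AB : A < B. Proof. by rewrite /B ltrDl. Qed.
Let B_gt0 : 0 < B. Proof. exact: lt_trans AB. Qed.
Let BT : B < T. Proof. by rewrite /T /B ltrD2l mulr2n ltrDl. Qed.
Let BA : B - A = L. Proof. by rewrite /B addrC addKr. Qed.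
Let p_gt0 : 0 < p. Proof. exact: lt_trans p_gt1. Qed.
Let q_gt0 : 0 < q. Proof. exact: lt_trans q_gt1. Qed.

Let K : R := (m.+1%:R / L) `^ (q / (q - 1)) * lam `^ (- (q - 1)^-1).

Let U t := heat (T - t) (fun y => u (clamp B t) (rV y)) a.

Let J_lt t : t \in `[A, B] -> 0 < T - t.
Proof.
by rewrite in_itv/= => /andP[_ tB]; rewrite subr_gt0 (le_lt_trans tB).
Qed.

Let mus t : measurable_fun setT (fun y => u (clamp B t) (rV y)).
Proof.
have mu2 := measurable_clamp_curve u_C (ltW B_gt0).
exact: (@measurable_fun_pair2 _ _ _ _ _ _ (fun z => u (clamp B z.1) (rV z.2)) t).
Qed.

Let mU : measurable_fun setT U.
Proof.
have mT : measurable_fun setT (fun s : R => T - s) by exact: measurable_funB.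
have mu2 := measurable_clamp_curve u_C (ltW B_gt0).
exact: (measurable_heat mT (measurable_cst a) mu2).
Qed.

Let integrable_J (h : R -> R) : leb.-integrable `[0, B] (EFin \o h) ->
  leb.-integrable `[A, B] (EFin \o (fun s => cutoff m A B s * h s)).
Proof.
move=> ih.
have ihJ : leb.-integrable `[A, B] (EFin \o h).
  by apply: integrableS ih => //; apply: subset_itvr; rewrite bnd_simp ltW.
have mh : measurable_fun `[A, B] h by case/integrableP : ihJ => /measurable_EFinP.
apply: le_integrable ihJ => //.
  apply/measurable_EFinP; apply: measurable_funM => //.
  apply: measurable_funTS; apply: continuous_measurable_fun.
  exact: continuous_cutoff.
move=> s sJ; rewrite lee_fin normrM ler_piMl//.
have /andP[z0 z1] := parabola_itv AB sJ.
by rewrite /cutoff ger0_norm ?exprn_ge0// exprn_ile1.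
Qed.

Let normr_cutoff'_le t : t \in `[A, B] ->
  `|cutoff' m A B t| <= m.+1%:R / L * parabola A B t ^+ m.
Proof.
move=> tJ; have /andP[z0 _] := parabola_itv AB tJ.
rewrite /cutoff' normrM ger0_norm; last by rewrite mulr_ge0 ?exprn_ge0.
rewrite [leRHS]mulrAC ler_wpM2l ?mulr_ge0 ?exprn_ge0//.
by rewrite -BA; exact: normr_parabola'_le.
Qed.

(** Young's inequality is applied pointwise in space and then averaged by the
    kernel, which is a probability density. *)
Let test_le t : t \in `[A, B] ->
  `|- cutoff' m A B t * U t| <=
  lam * (cutoff m A B t * source_pairing q B T u a t) + K.
Proof.
move=> tJ; have Tt := J_lt tJ.
have [M uM] := C_in_C0_bounded u_C.
have uMt y : `|u (clamp B t) (rV y)| <= M.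
  by apply: uM; apply: clamp_in; exact: ltW.
have M0 : 0 <= M by exact: le_trans (uMt a).
have /andP[z0 z1] := parabola_itv AB tJ.
set z := parabola A B t in z0 z1.
have D0 : 0 <= m.+1%:R / L by rewrite divr_ge0// ltW.
have mn : measurable_fun setT (fun y => `|u (clamp B t) (rV y)|).
  exact: measurableT_comp.
have mnq : measurable_fun setT (fun y => `|u (clamp B t) (rV y)| `^ q).
  exact: (@measurableT_comp _ _ _ _ _ _ (fun b : R => b `^ q)).
have nM y : `| `|u (clamp B t) (rV y)| | <= M by rewrite normr_id.
have nqM y : `| `|u (clamp B t) (rV y)| `^ q | <= M `^ q.
  rewrite ger0_norm ?powR_ge0// ge0_ler_powR ?nnegrE//; exact: ltW.
have z'0 : 0 <= lam * z ^+ m.+1 by rewrite mulr_ge0 ?exprn_ge0 ?(ltW lam_gt0).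
rewrite normrM normrN.
apply: le_trans (_ : m.+1%:R / L * z ^+ m *
    heat (T - t) (fun y => `|u (clamp B t) (rV y)|) a <= _).
  apply: ler_pM => //; first exact: normr_cutoff'_le.
  exact: ler_norm_heat uMt.
rewrite mulrA /source_pairing -/z -(heatZ _ _ Tt mn nM) -(heatZ _ _ Tt mnq nqM).
rewrite -[in leRHS](heat_cst K a Tt).
have mc1 : measurable_fun setT
  (fun y => lam * cutoff m A B t * `|u (clamp B t) (rV y)| `^ q).
  exact: measurable_funM.
have mc2 : measurable_fun setT (fun _ : X => K) by exact: measurable_cst.
have c1M y : `|lam * cutoff m A B t * `|u (clamp B t) (rV y)| `^ q| <=
    lam * z ^+ m.+1 * M `^ q.
  rewrite normrM ger0_norm// ler_wpM2l//.
have c2M (y : X) : `|K| <= `|K| by [].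
rewrite -(heatD _ Tt mc1 mc2 c1M c2M).
apply: (@ler_heat _ _ _ (m.+1%:R / L * z ^+ m * M)
    (lam * z ^+ m.+1 * M `^ q + `|K|)) => //.
- exact: measurable_funM.
- exact: measurable_funD.
- by move=> y; rewrite normrM normr_id ger0_norm ?ler_wpM2l// mulr_ge0 ?exprn_ge0.
- by move=> y; rewrite (le_trans (ler_normD _ _))// lerD.
- by move=> y; apply: young_weighted => //; rewrite z0.
Qed.

Let pairing_increment t : t \in `[A, B] ->
  U t - heat T (f0 \o rV) a =
  (\int[leb]_(s in `[0, t[) (source_pairing p B T g a s + forcing_pairing al T w a s))%R.
Proof.
rewrite in_itv/= => /andP[At tB]; have t0 := lt_le_trans A_gt0 At.
have sub : (`[0, t[%classic : set R) `<=` `[0, B]%classic.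
  by apply: subset_itvl; rewrite bnd_simp.
rewrite /U clampE ?in_itv/= ?tB ?(ltW t0)//.
have tB0 : 0 < t <= B by rewrite t0.
have -> := mild_pairing a al_gtN1 B_gt0 BT (ltW p_gt0) f0_C0 w_C0 g_C u_duhamel tB0.
rewrite RintegralD//.
- by ring.
- apply: integrableS (integrable_source_pairing a B_gt0 BT (ltW p_gt0) g_C) => //.
- exact: integrableS (integrable_forcing_pairing a al_gtN1 BT w_C0).
Qed.

(** Integrating minus the derivative of the cutoff against the increment of the
    paired solution gives the cutoff against source plus forcing
    ([Rintegral_triangle]); the constant [heat T f0] drops out because the cutoff
    vanishes at both ends. The paired solution itself is bounded by Young's
    inequality. On the window the time argument [T - s] of the kernel lies between
    [L] and [2 L]. *)
Lemma tested_inequality :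
  tested_source p g + wmin * delta * (8^-1 ^+ m.+1 / 2 * L) <=
  lam * tested_source q u + K * L.
Proof.
pose th t := - cutoff' m A B t.
pose c := heat T (f0 \o rV) a.
have mth : measurable_fun setT th.
  apply: continuous_measurable_fun => t; apply: continuousN.
  exact: continuous_cutoff'.
have thC t : t \in `[A, B] -> `|th t| <= m.+1%:R / L.
  move=> tJ; rewrite normrN (le_trans (normr_cutoff'_le tJ))//.
  have /andP[z0 z1] := parabola_itv AB tJ.
  by rewrite ler_piMr ?exprn_ile1// divr_ge0// ltW.
have iS := integrable_source_pairing a B_gt0 BT (ltW p_gt0) g_C.
have iSu := integrable_source_pairing a B_gt0 BT (ltW q_gt0) u_C.
have iF := integrable_forcing_pairing a al_gtN1 BT w_C0.
have iSF : leb.-integrable `[0, B] (EFin \o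
    (fun s => source_pairing p B T g a s + forcing_pairing al T w a s)).
  exact: (integrableD _ iS iF).
have iJ : leb.-integrable `[A, B] (EFin \o th).
  exact: integrable_bounded_itv mth thC.
have [M uM] := C_in_C0_bounded u_C.
have UM t : t \in `[A, B] -> `|U t| <= M.
  move=> tJ; apply: heat_le; [exact: mus| |exact: J_lt].
  by move=> y; apply: uM; apply: clamp_in; exact: ltW.
have iJU : leb.-integrable `[A, B] (EFin \o (fun t => th t * U t)).
  apply: (@integrable_bounded_itv _ _ (m.+1%:R / L * M)).
    exact: measurable_funM.
  by move=> t tJ; rewrite normrM ler_pM ?thC ?UM.
have th0 : (\int[leb]_(t in `[A, B]) th t)%R = 0.
  rewrite -Rintegral_itv_obnd_cbnd; last first.
    by apply: integrableS iJ => //; exact: subset_itv_oc_cc.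
  by rewrite Rintegral_cutoff' ?in_itv/= ?lexx ?cutoff_endl ?ltW.
have tri := Rintegral_triangle (ltW A_gt0) (ltW AB) mth thC iSF
  (fun s => @Rintegral_cutoff' _ m A B s AB) (cutoff_endl m A B).
have tU : (\int[leb]_(t in `[A, B]) (th t * \int[leb]_(s in `[0, t[)
      (source_pairing p B T g a s + forcing_pairing al T w a s))
    = \int[leb]_(t in `[A, B]) (th t * U t))%R.
  transitivity (\int[leb]_(t in `[A, B]) (th t * U t - th t * c))%R.
    apply: eq_Rintegral => t; rewrite inE/= => tJ.
    by rewrite -pairing_increment// mulrBr.
  rewrite RintegralB//; first by rewrite RintegralZr// th0 mul0r subr0.
  apply: (@integrable_bounded_itv _ _ (m.+1%:R / L * `|c|)).
    exact: measurable_funM.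
  by move=> t tJ; rewrite normrM ler_wpM2r// thC.
rewrite tU in tri.
have leU : (\int[leb]_(t in `[A, B]) (th t * U t) <= lam * tested_source q u + K * L)%R.
  have iK : leb.-integrable `[A, B] (EFin \o (fun=> K)).
    by apply: (@integrable_bounded_itv _ _ `|K|) => //; exact: measurable_cst.
  have iC := integrable_J iSu.
  have iC' : leb.-integrable `[A, B] (EFin \o (fun t =>
      lam * (cutoff m A B t * source_pairing q B T u a t))).
    under [X in integrable _ _ X]eq_fun do rewrite EFinM.
    exact: integrableZl.
  rewrite /tested_source -RintegralZl//.
  have -> : K * L = (\int[leb]_(t in `[A, B]) K)%R.
    have JL : fine (leb (`[A, B]%classic : set R)) = L.
      by rewrite lebesgue_measure_itv /= lte_fin AB /= BA.
    by rewrite Rintegral_cst// JL.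
  rewrite -RintegralD//; apply: le_Rintegral => //; first exact: (integrableD _ iC' iK).
  by move=> t tJ; rewrite (le_trans (ler_norm _))// test_le.
apply: le_trans leU; rewrite tri.
under [leRHS]eq_Rintegral do rewrite mulrDr.
rewrite (RintegralD _ (integrable_J iS) (integrable_J iF))//.
rewrite lerD2l.
have ic : leb.-integrable `[A, B] (EFin \o cutoff m A B).
  apply: continuous_compact_integrable; first exact: segment_compact.
  by apply: continuous_subspaceT; exact: continuous_cutoff.
apply: le_trans (_ : wmin * delta * \int[leb]_(s in `[A, B]) cutoff m A B s <= _)%R.
  rewrite ler_wpM2l ?mulr_ge0//.
  by have := Rintegral_cutoff_ge m AB; rewrite BA.
rewrite -RintegralZl//; apply: le_Rintegral => //.
- under [X in integrable _ _ X]eq_fun do rewrite EFinM.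
  exact: integrableZl.
- exact: integrable_J.
move=> s sJ; rewrite mulrC ler_wpM2l//.
  have /andP[z0 _] := parabola_itv AB sJ; exact: exprn_ge0.
apply: ler_pM => //; first exact: wmin_le.
apply: w_pairing; move: sJ; rewrite /= in_itv/= /T /B mulr2n => /andP[As sB].
by apply/andP; split; lra.
Qed.

End component.

(** * Forcing of positive mass *)

Section mass.
Context {R : realType} {N : nat}.
Local Notation X := (N.-tuple R).
Local Notation mu := (@muN R N).
Local Notation RN := 'rV[R]_N.
Local Notation rV := (@rV_of_tuple R N).

Definition origin : X := [tuple of nseq N 0].

(** The absolute value makes this at most 1 for all [t], so that dominated
    convergence can be applied along every sequence tending to infinity. *)
Let gauss (t : R) (y : X) : R := expR (- (sqnorm (rV origin - rV y) / (4 * `|t|))).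

Lemma sqnorm_ge0 (x : RN) : 0 <= sqnorm x.
Proof. by apply: sumr_ge0 => i _; exact: sqr_ge0. Qed.

Let gauss_le1 t y : gauss t y <= 1.
Proof.
by rewrite /gauss -expR0 ler_expR oppr_le0 divr_ge0 ?sqnorm_ge0 ?mulr_ge0.
Qed.

Variable w : RN -> R.
Hypotheses (w_C0 : C0_RN w) (w_L1 : L1_RN w).

Let mw : measurable_fun setT (w \o rV).
Proof. by apply: measurable_comp_rV_of_tuple; case: w_C0. Qed.

Let mgauss t : measurable_fun setT (gauss t).
Proof.
apply: measurableT_comp => //; apply: measurableT_comp => //.
apply: measurable_funM => //; apply: measurable_sum => i.
apply: measurable_funX; under eq_fun do rewrite !mxE.
apply: measurable_funB => //; exact: measurable_tnth.
Qed.

Lemma cvg_gauss_pairing :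
  (\int[mu]_y (gauss t y * w (rV y)))%R @[t --> +oo] --> integral_RN w.
Proof.
apply/cvg_pinftyP => t tn.
have mf n : measurable_fun setT (fun y => (gauss (t n) y * w (rV y))%:E).
  by apply/measurable_EFinP; exact: measurable_funM.
have tV : (4 * `|t n|)^-1 @[n --> \oo] --> (0 : R).
  have tN : \forall n \near \oo, 0 < t n by move/cvgryPgt : tn; exact.
  apply/gtr0_cvgV0; first by apply: filterS tN => n tn0; rewrite mulr_gt0// normr_gt0 gt_eqF.
  apply/cvgryPge => A; move/cvgryPge : tn => /(_ A); apply: filterS => n An.
  by have := ler_norm (t n); have := normr_ge0 (t n); lra.
have gw : {ae mu, forall y, setT y ->
    (gauss (t n) y * w (rV y))%:E @[n --> \oo] --> (w (rV y))%:E}.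
  apply: aeW => y _; apply: cvg_EFin; first by apply: nearW.
  rewrite -[X in _ --> X]mul1r; apply: cvgM; last exact: cvg_cst.
  rewrite -expR0; apply: continuous_cvg; first exact: continuous_expR.
  rewrite -oppr0; apply: cvgN.
  rewrite -[X in _ --> X](mulr0 (sqnorm (rV origin - rV y))).
  by apply: cvgM; [exact: cvg_cst|exact: tV].
have gle : {ae mu, forall y n, setT y ->
    (`|(gauss (t n) y * w (rV y))%:E| <= `|(w (rV y))%:E|)%E}.
  apply: aeW => y n _; rewrite lee_fin normrM ler_piMl//.
  by rewrite ger0_norm ?expR_ge0.
have mwE : measurable_fun setT (fun y => (w (rV y))%:E) by exact/measurable_EFinP.
have [_ _ dc] := dominated_convergence measurableT mf mwE gw
  (integrable_abse w_L1) gle.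
apply: fine_cvg; rewrite /integral_RN /Rintegral fineK//.
exact: integrable_fin_num w_L1.
Qed.

Hypothesis w_pos : 0 < integral_RN w.

(** The kernel at the origin is (4 pi t)^(-N/2) times a Gaussian that tends to 1,
    so (S(t) w)(0) behaves like (4 pi t)^(-N/2) times the mass of [w]; half of the
    mass is kept. *)
Lemma heat_origin_ge : exists c L0, [/\ 0 < c, 0 < L0 & forall t, L0 <= t ->
  c * t `^ (- (N%:R / 2)) <= heat t (w \o rV) origin].
Proof.
have w2 : integral_RN w / 2 < integral_RN w by move: (w_pos) => h; lra.
have [M [_ hM]] := cvgr_gt _ cvg_gauss_pairing _ w2.
have c0 : 0 < (4 * pi : R) `^ (- (N%:R / 2)) 
  by apply: powR_gt0; rewrite mulr_gt0 ?pi_gt0.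
exists ((4 * pi) `^ (- (N%:R / 2)) * (integral_RN w / 2)), (`|M| + 1).
split; [by rewrite mulr_gt0 ?divr_gt0|by rewrite ltr_wpDl|].
move=> t tM; have t0 : 0 < t by rewrite (lt_le_trans _ tM)// ltr_wpDl.
have Mt : M < t by rewrite (lt_le_trans _ tM)// (le_lt_trans (ler_norm M))// ltrDl.
have -> : heat t (w \o rV) origin = (4 * pi) `^ (- (N%:R / 2)) * t `^ (- (N%:R / 2)) *
    (\int[mu]_y (gauss t y * w (rV y)))%R.
  rewrite -RintegralZl//.
    apply: eq_Rintegral => y _; rewrite /gauss /kernel /heat_kernel ger0_norm ?(ltW t0)//.
    by rewrite [in LHS]powRM ?mulr_ge0 ?pi_ge0 ?(ltW t0)// mulrA.
  apply: (@integrable_le _ _ _ mu _ (fun y => `|w (rV y)|)).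
  - exact: measurable_funM.
  - exact: integrable_norm w_L1.
  - by move=> y; rewrite normrM ler_piMl// ger0_norm ?expR_ge0.
rewrite mulrAC ler_wpM2l ?mulr_ge0 ?powR_ge0//; exact/ltW/hM.
Qed.

End mass.

(** * The coupled system on a window, and blow-up *)

Section real_inequalities.
Context {R : realType}.
Implicit Types x y r s : R.

Lemma ler_powRN x y r : 0 < x -> x <= y -> 0 <= r -> y `^ (- r) <= x `^ (- r).
Proof.
move=> x0 xy r0; have y0 := lt_le_trans x0 xy.
rewrite !powRN lef_pV2 ?posrE ?powR_gt0//.
by rewrite ge0_ler_powR// nnegrE ltW.
Qed.

Lemma powRVN x r : 0 <= x -> x^-1 `^ r = x `^ (- r).
Proof. by move=> x0; rewrite -powR_inv1// -powRrM mulN1r. Qed.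

Lemma powR_unbounded (C1 C2 r L0 : R) : 0 < C1 -> 0 < r ->
  exists L, [/\ 0 < L, L0 <= L & C2 < C1 * L `^ r].
Proof.
move=> C10 r0; set b := `|C2| / C1 + 1.
have b0 : 0 < b by rewrite ltr_wpDl// divr_ge0// ltW.
exists (Num.max `|L0| (b `^ r^-1)); split.
- by rewrite lt_max [X in _ || X]powR_gt0 ?orbT.
- by rewrite le_max ler_norm.
have : b <= Num.max `|L0| (b `^ r^-1) `^ r.
  rewrite -{1}[b]powRr1 ?(ltW b0)// -[X in b `^ X](mulVf (lt0r_neq0 r0)) powRrM.
  by rewrite ge0_ler_powR ?nnegrE ?powR_ge0 ?(ltW r0)// le_max ?lexx ?orbT ?normr_ge0.
rewrite -(ler_pM2l C10); apply: lt_le_trans.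
rewrite /b mulrDr mulr1 mulrC divfK ?gt_eqF// (le_lt_trans (ler_norm _))//.
by rewrite ltrDl.
Qed.

(** The weights [l] and [l^-1] of the two tested inequalities are chosen so that
    the sources [S1] and [S2] cancel. *)
Lemma eliminate_sources (W S1 S2 K1 K2 l L : R) :
  S1 + W <= l * S2 + K1 * L -> l * S2 <= S1 + l * (K2 * L) ->
  W <= (K1 + l * K2) * L.
Proof. by rewrite mulrDl -mulrA; lra. Qed.

Lemma le_sum_products (a b c d e f : R) :
  0 <= a -> 0 <= b -> 0 <= c -> 0 <= d -> 0 <= e -> 0 <= f ->
  a * b * c + d * e * f <= (d + a) * (f * e + c * b).
Proof.
move=> a0 b0 c0 d0 e0 f0.
have h1 : 0 <= d * c * b by rewrite !mulr_ge0.
have h2 : 0 <= a * f * e by rewrite !mulr_ge0.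
by nra.
Qed.

End real_inequalities.

Section coupling.
Context {R : realType} {N : nat}.
Local Notation RN := 'rV[R]_N.
Local Notation rV := (@rV_of_tuple R N).
Variables (p q sigma gamma : R) (u0 v0 w1 w2 : RN -> R) (u v : R -> RN -> R).
Hypotheses (p_gt1 : 1 < p) (q_gt1 : 1 < q).
Hypotheses (sigma_gtN1 : -1 < sigma) (gamma_gtN1 : -1 < gamma).
Hypotheses (u0_C0 : C0_RN u0) (v0_C0 : C0_RN v0).
Hypotheses (w1_C0 : C0_RN w1) (w2_C0 : C0_RN w2).
Hypotheses (w1_L1 : L1_RN w1) (w2_L1 : L1_RN w2).
Hypotheses (w1_pos : 0 < integral_RN w1) (w2_pos : 0 < integral_RN w2).
Hypothesis uv_global : forall tau, 0 < tau ->
  mild_solution p q sigma gamma u0 v0 w1 w2 tau u v.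

(** The tested inequality of the second equation, whose forcing term is
    nonnegative, bounds the source |u|^q that appears in the first one by |v|^p. *)
Lemma forcing_bound : exists C1 C2 L0 : R, [/\ 0 < C1, 0 < L0 &
  forall A L lam wmin : R, 0 < A -> L0 <= L -> 0 < lam -> 0 <= wmin ->
    (forall s, s \in `[A, A + L] -> wmin <= s `^ sigma) ->
  wmin * C1 * L `^ (- (N%:R / 2)) <=
  C2 * (lam `^ (p / (p - 1)) * L `^ (- (p / (p - 1))) +
        lam `^ (- (q - 1)^-1) * L `^ (- (q / (q - 1))))].
Proof.
have p0 : 0 < p by exact: lt_trans p_gt1.
have q0 : 0 < q by exact: lt_trans q_gt1.
have pm0 : 0 < p - 1 by rewrite subr_gt0.
have qm0 : 0 < q - 1 by rewrite subr_gt0.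
have [c [L1 [c0 L10 w1_ge]]] := heat_origin_ge w1_C0 w1_L1 w1_pos.
have [c' [L2 [c'0 L20 w2_ge]]] := heat_origin_ge w2_C0 w2_L1 w2_pos.
(* Large enough for Young's inequality with both exponents. *)
pose m := (Num.truncn (Num.max (p - 1)^-1 (q - 1)^-1)).+1.
have mP r : 0 < r -> r^-1 <= Num.max (p - 1)^-1 (q - 1)^-1 -> 1 <= m%:R * r.
  move=> r0 rm; rewrite -ler_pdivrMr// div1r (le_trans rm)// ltW//.
  exact: truncnS_gt.
have mp : 1 <= m%:R * (p - 1) by apply: mP; rewrite ?le_max ?lexx.
have mq : 1 <= m%:R * (q - 1) by apply: mP; rewrite ?le_max ?lexx ?orbT.
pose k : R := 8^-1 ^+ m.+1 / 2.
have k0 : 0 < k by rewrite divr_gt0 ?exprn_gt0.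
have N0 : 0 <= N%:R / 2 :> R by rewrite divr_ge0.
pose D : R := m.+1%:R.
have D0 : 0 <= D by [].
exists (c * 2 `^ (- (N%:R / 2)) * k).
exists (D `^ (p / (p - 1)) + D `^ (q / (q - 1))), (Num.max L1 L2).
have t0 : 0 < 2 `^ (- (N%:R / 2)) :> R by apply: powR_gt0.
split; [exact: mulr_gt0 (mulr_gt0 c0 t0) k0|by rewrite lt_max L10|].
move=> A L lam wmin A0; rewrite ge_max => /andP[LL1 LL2] l0 wm0 wm.
have L0 : 0 < L by exact: lt_le_trans LL1.
have B0 : 0 < A + L by rewrite addr_gt0.
have [uC vC uv] := uv_global B0.
have li0 : 0 < lam^-1 by rewrite invr_gt0.
pose delta := c * (L *+ 2) `^ (- (N%:R / 2)).
have d0 : 0 <= delta by rewrite mulr_ge0 ?powR_ge0 ?ltW.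
have w1d t : L <= t <= L *+ 2 -> delta <= heat t (w1 \o rV) origin.
  move=> /andP[Lt tL]; apply: le_trans (w1_ge _ (le_trans LL1 Lt)).
  by rewrite ler_wpM2l ?(ltW c0)// ler_powRN// (lt_le_trans L0).
have w2d t : L <= t <= L *+ 2 -> 0 <= heat t (w2 \o rV) origin.
  move=> /andP[Lt tL]; apply: le_trans (w2_ge _ (le_trans LL2 Lt)).
  by rewrite mulr_ge0 ?powR_ge0 ?ltW.
have ineq1 := tested_inequality sigma_gtN1 p_gt1 q_gt1 A0 L0 l0 mq u0_C0 w1_C0
  vC uC (fun t x tB => (uv t x tB).1) d0 w1d wm0 wm.
have ineq2 := tested_inequality gamma_gtN1 q_gt1 p_gt1 A0 L0 li0 mp v0_C0 w2_C0
  uC vC (fun t x tB => (uv t x tB).2) (lexx 0) w2d (lexx 0) (fun s _ => powR_ge0 s gamma).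
rewrite mul0r mul0r addr0 in ineq2.
have {ineq2} := ler_wpM2l (ltW l0) ineq2.
rewrite mulrDr mulVKf ?gt_eqF// => ineq2.
have {ineq1 ineq2} := eliminate_sources ineq1 ineq2.
rewrite -/k -/D => ineq.
rewrite [X in X <= _]mulrA ler_pM2r// in ineq.
have DL r : (D / L) `^ r = D `^ r * L `^ (- r).
  by rewrite powRM ?invr_ge0 ?(ltW L0)// powRVN// ltW.
have lamp : lam * lam^-1 `^ (- (p - 1)^-1) = lam `^ (p / (p - 1)).
  rewrite powRVN ?(ltW l0)// opprK -{1}[lam]powRr1 ?(ltW l0)// -powRD.
    by congr (_ `^ _); field; rewrite gt_eqF.
  by rewrite (gt_eqF l0) implybT.
rewrite [X in _ <= _ + X]mulrCA lamp !DL in ineq.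
rewrite /delta -(mulr_natl L) powRM ?(ltW L0)// in ineq.
rewrite [leLHS](_ : _ = wmin * (c * (2%:R `^ (- (N%:R / 2)) * L `^ (- (N%:R / 2)))) * k).
  apply: le_trans ineq _.
  by apply: le_sum_products; exact: powR_ge0.
by ring.
Qed.

(** At late times the forcing is arbitrarily large, while on windows of a fixed
    length, with [lam] equal to 1, the right side of [forcing_bound] is constant. *)
Lemma not_global_of_sigma_gt0 : 0 < sigma -> False.
Proof.
move=> s0; have [C1 [C2 [L0 [C10 L00 bound]]]] := forcing_bound.
set E := C2 * (1 `^ (p / (p - 1)) * L0 `^ (- (p / (p - 1))) +
        1 `^ (- (q - 1)^-1) * L0 `^ (- (q / (q - 1)))).
have C1L : 0 < C1 * L0 `^ (- (N%:R / 2)) by rewrite mulr_gt0// powR_gt0.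
have [A [A0 _ hA]] := powR_unbounded E 0 C1L s0.
have AL s : s \in `[A, A + L0] -> A `^ sigma <= s `^ sigma.
  rewrite in_itv/= => /andP[As _].
  by rewrite ge0_ler_powR ?nnegrE ?(ltW s0) ?(ltW A0)// (le_trans (ltW A0)).
have := bound A L0 1 (A `^ sigma) A0 (lexx _) ltr01 (powR_ge0 _ _) AL.
by rewrite -/E -mulrA mulrC leNgt hA.
Qed.

(** On the window from [L] to [2 L] the forcing is of size L^sigma, and the bound
    reads L^(sigma - N/2) <= C L^(-e) with the optimal [lam]. *)
Lemma not_global_of_sigma_lt0 : sigma < 0 ->
  N%:R / 2 < sigma + p * (q + 1) / (p * q - 1) -> False.
Proof.
move=> s0 Ns; have [C1 [C2 [L0 [C10 L00 bound]]]] := forcing_bound.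
have pq : 0 < p * q - 1.
  by rewrite subr_gt0 (lt_trans p_gt1)// ltr_pMr// (lt_trans _ p_gt1).
have pm0 : p - 1 != 0 by rewrite gt_eqF// subr_gt0.
have qm0 : q - 1 != 0 by rewrite gt_eqF// subr_gt0.
have pq0 : p * q - 1 != 0 by rewrite gt_eqF.
set e := p * (q + 1) / (p * q - 1) in Ns.
have th0 : 0 < sigma - N%:R / 2 + e by rewrite addrAC subr_gt0.
have C2s : 0 < C1 * 2 `^ sigma by rewrite mulr_gt0// powR_gt0.
have [L [Lp LL hL]] := powR_unbounded (2 * C2) L0 C2s th0.
have Ls s : s \in `[L, L + L] -> (L *+ 2) `^ sigma <= s `^ sigma.
  rewrite in_itv/= -mulr2n => /andP[Ls sL]; rewrite -[sigma]opprK.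
  by rewrite ler_powRN// ?(lt_le_trans Lp)// oppr_ge0 ltW.
(* With [lam = L `^ a] both terms of the bound are the same power of [L]. *)
pose a := (q - p) / (p * q - 1).
have L_neq0 : L != 0 by rewrite gt_eqF.
have LD r s : L `^ r * L `^ s = L `^ (r + s).
  by rewrite powRD// L_neq0 implybT.
have := bound L L (L `^ a) ((L *+ 2) `^ sigma) Lp LL (powR_gt0 _ Lp) (powR_ge0 _ _) Ls.
rewrite -!powRrM !LD.
rewrite (_ : a * (p / (p - 1)) + - (p / (p - 1)) = - e); last first.
  by rewrite /a /e; field; rewrite pq0 pm0.
rewrite (_ : a * - (q - 1)^-1 + - (q / (q - 1)) = - e); last first.
  by rewrite /a /e; field; rewrite pq0 qm0.
rewrite -(mulr_natl L) powRM ?(ltW Lp)// => ineq.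
have Le : 0 < L `^ e by exact: powR_gt0.
have LeN : L `^ (- e) * L `^ e = 1 by rewrite LD addNr powRr0.
rewrite -!LD in hL.
have := ler_wpM2r (ltW Le) ineq.
rewrite [leRHS](_ : _ = 2 * C2 * (L `^ (- e) * L `^ e)); last by ring.
rewrite LeN mulr1 leNgt => /negP; apply; apply: lt_le_trans hL _.
by rewrite le_eqVlt; apply/orP; left; apply/eqP; ring.
Qed.

End coupling.

Theorem theorem1p3 (R : realType) (N : nat) (p q sigma gamma : R)
    (u0 v0 w1 w2 : 'rV[R]_N -> R) (u v : R -> 'rV[R]_N -> R)
    (N_ge1 : (1 <= N)%N) (p_gt1 : 1 < p) (q_gt1 : 1 < q)
    (sigma_gtN1 : -1 < sigma) (gamma_gtN1 : -1 < gamma)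
    (sigma_neq0 : sigma != 0) (gamma_neq0 : gamma != 0)
    (u0_C0 : C0_RN u0) (v0_C0 : C0_RN v0)
    (w1_C0 : C0_RN w1) (w2_C0 : C0_RN w2) (w1_L1 : L1_RN w1) (w2_L1 : L1_RN w2)
    (int_w1_gt0 : 0 < integral_RN w1) (int_w2_gt0 : 0 < integral_RN w2)
    (uv_sol : maximal_mild_solution p q sigma gamma u0 v0 w1 w2 u v) :
  (sigma < 0 -> gamma < 0 ->
   N%:R / 2 < Num.max (((sigma + 1) * (p * q - 1) + p + 1) / (p * q - 1))
                      (((gamma + 1) * (p * q - 1) + q + 1) / (p * q - 1)) ->
   blows_up_in_finite_time p q sigma gamma u0 v0 w1 w2) /\
  (0 < sigma \/ 0 < gamma ->
   blows_up_in_finite_time p q sigma gamma u0 v0 w1 w2).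
Proof.
have global : ~ blows_up_in_finite_time p q sigma gamma u0 v0 w1 w2 ->
    forall tau, 0 < tau -> mild_solution p q sigma gamma u0 v0 w1 w2 tau u v.
  rewrite /blows_up_in_finite_time => /negP; rewrite -leNgt leye_eq => /eqP Ty tau tau0.
  by have [_] := uv_sol; apply; rewrite // Ty ltry.
have swap : (forall tau, 0 < tau ->
      mild_solution p q sigma gamma u0 v0 w1 w2 tau u v) ->
    forall tau, 0 < tau -> mild_solution q p gamma sigma v0 u0 w2 w1 tau v u.
  move=> uv tau tau0; have [uC vC e] := uv tau tau0.
  by split=> // t x tB; have [e1 e2] := e t x tB.
have pq : p * q - 1 != 0.
  rewrite gt_eqF// subr_gt0 (lt_trans p_gt1)// ltr_pMr//.
  exact: lt_trans p_gt1.
split.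
  move=> s0 g0; rewrite lt_max => N_small; apply: contrapT => /global uv.
  have vu := swap uv; case/orP: N_small => N_small.
    apply: (not_global_of_sigma_lt0 p_gt1 q_gt1 sigma_gtN1 gamma_gtN1 u0_C0 v0_C0
      w1_C0 w2_C0 w1_L1 w2_L1 int_w1_gt0 int_w2_gt0 uv s0).
    by apply: lt_le_trans N_small _; rewrite le_eqVlt (_ : _ == _)//; apply/eqP; field.
  apply: (not_global_of_sigma_lt0 q_gt1 p_gt1 gamma_gtN1 sigma_gtN1 v0_C0 u0_C0
    w2_C0 w1_C0 w2_L1 w1_L1 int_w2_gt0 int_w1_gt0 vu g0).
  apply: lt_le_trans N_small _; rewrite le_eqVlt (_ : _ == _)//; apply/eqP.
  by field; rewrite mulrC pq.
move=> sg; apply: contrapT => /global uv; have vu := swap uv; case: sg => s0.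
  exact: (not_global_of_sigma_gt0 p_gt1 q_gt1 sigma_gtN1 gamma_gtN1 u0_C0 v0_C0
    w1_C0 w2_C0 w1_L1 w2_L1 int_w1_gt0 int_w2_gt0 uv s0).
exact: (not_global_of_sigma_gt0 q_gt1 p_gt1 gamma_gtN1 sigma_gtN1 v0_C0 u0_C0
  w2_C0 w1_C0 w2_L1 w1_L1 int_w2_gt0 int_w1_gt0 vu s0).
Qed.
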